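(* Let $d\ge1$, $k\ge 2$, $R>1$, and let $\mathcal{D}$ be a distribution over $\mathbb{R}^d$ with mean $\mu$ satisfying $\|\mu\|_2\le R$ and $\mathbb{E}_{X\sim\mathcal{D}}[|\langle X-\mu,v\rangle|^k]\le 1$ for every unit vector $v\in\mathbb{R}^d$. Then for all $\varepsilon,\alpha,\beta>0$ there exists an $\varepsilon$-differentially private algorithm which, given $$n\ge c\left(\frac{d\log(d/\beta)}{\alpha^2}+\frac{d\log(d/\beta)}{\varepsilon\,\alpha^{k/(k-1)}}+\frac{d\log(R)\log(d/\beta)}{\varepsilon}\right)$$ i.i.d. samples from $\mathcal{D}$ (for a suitable absolute constant $c$), outputs $\hat\mu\in\mathbb{R}^d$ such that with probability at least $1-\beta$, $\|\mu-\hat\mu\|_2\le\alpha$.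
   Context: A randomized algorithm $M$ is $\varepsilon$-differentially private if for all datasets $X,X'$ differing in exactly one entry and every measurable output set $Y$, $\Pr[M(X)\in Y]\le e^\varepsilon\Pr[M(X')\in Y]$.
   Formalization: The constant c is absolute only for α ≤ a0 and β ≤ b0, with any fixed caps a0 > 0 and b0 < 1 on which it may depend: no single c works for arbitrarily large α, or for d = 1 and β near 1. The algorithm does not depend on the distribution D. *)

(* Defs.v *)
From HB Require Import structures.
From mathcomp Require Export all_boot all_order all_algebra.
From mathcomp Require Export all_classical all_reals all_analysis.
From mathcomp Require Export measurable_realfun.

Set Implicit Arguments.
Unset Strict Implicit.
Unset Printing Implicit Defensive.

Import Order.TTheory GRing.Theory Num.Theory.
Import numFieldNormedType.Exports.

Local Open Scope classical_set_scope.
Local Open Scope ring_scope.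

(* R^d is [d.-tuple R]: the library equips it with the product of the Borel
   sigma-algebras, i.e. the Borel sigma-algebra of R^d. *)

Section euclidean.
Context {R : realType} {d : nat}.

Definition subt (x y : d.-tuple R) : d.-tuple R :=
  [tuple tnth x i - tnth y i | i < d].

Definition dot (x y : d.-tuple R) : R := \sum_(i < d) tnth x i * tnth y i.

Definition norm2 (x : d.-tuple R) : R := Num.sqrt (dot x x).

End euclidean.

Section distribution_on_Rd.
Context {R : realType} {d : nat} (D : probability (d.-tuple R) R).

Definition has_mean (mu : d.-tuple R) : Prop :=
  forall i : 'I_d,
    D.-integrable setT (EFin \o (fun x => tnth x i)) /\
    ('E_D[fun x => tnth x i] = (tnth mu i)%:E)%E.

(* Order k may be any real number. *)
Definition central_moment_le1 (mu : d.-tuple R) (k : R) : Prop :=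
  forall v : d.-tuple R, norm2 v = 1 ->
    ('E_D[fun x => (`|dot (subt x mu) v| `^ k)%R] <= 1)%E.

End distribution_on_Rd.

Section samples.
Context {dT : measure_display} {T : measurableType dT} {R : realType}.
Context {dO : measure_display} {O : measurableType dO} (P : probability O R).

Definition mutually_independent (n : nat) (X : 'I_n -> {mfun O >-> T}) : Prop :=
  forall (J : {set 'I_n}) (B : 'I_n -> set T),
    (forall i, measurable (B i)) ->
    P (\bigcap_(i in [set` J]) (X i @^-1` B i)) =
      (\prod_(i in J) P (X i @^-1` B i))%E.

Definition iid (n : nat) (X : 'I_n -> {mfun O >-> T}) (D : probability T R) :
    Prop :=
  mutually_independent X /\
  (forall i (B : set T), measurable B -> distribution P (X i) B = D B).

End samples.

Section privacy.
Context {dT dY : measure_display} {T : measurableType dT}.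
Context {Y : measurableType dY} {R : realType}.

Definition neighbours (n : nat) (x x' : n.-tuple T) : Prop :=
  exists i : 'I_n, tnth x i <> tnth x' i /\
    forall j : 'I_n, j != i -> tnth x j = tnth x' j.

(* A randomized algorithm: for each dataset size n, a probability kernel from
   datasets of n entries to outputs; [M n x A] is Pr[M(x) \in A]. *)
Definition algorithm := forall n : nat, R.-pker (n.-tuple T) ~> Y.

Definition differentially_private (eps : R) (M : algorithm) : Prop :=
  forall (n : nat) (x x' : n.-tuple T), neighbours x x' ->
    forall A : set Y, measurable A -> (M n x A <= (expR eps)%:E * M n x' A)%E.

(* Pr[M(X_1, .., X_n) \in A], over both the sample and the algorithm's coins. *)
Definition output_prob {dO : measure_display} {O : measurableType dO}
    (P : probability O R) (M : algorithm) (n : nat)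
    (X : 'I_n -> {mfun O >-> T}) (A : set Y) : \bar R :=
  (\int[P]_w M n [tuple X i w | i < n] A)%E.

End privacy.

Arguments algorithm {dT dY} T Y R.

(* The constant c multiplying this bound can be uniform in d, k, r, eps, n and
   the distribution, for alpha in any bounded range and beta in any range
   bounded away from 1, but not beyond that:
   - one sample (n = 1, d = 1, k = 2, eps large) is allowed as soon as
     alpha^2 is a multiple of ln (1 / beta), yet two distributions of variance
     at most 1 whose means are more than 2 alpha apart can share an atom of
     mass 1 / (4 alpha^2), far larger than beta;
   - for d = 1, ln (d / beta) tends to 0 as beta tends to 1, while separating
     the r / 3 point masses at 3, 6, .., r takes eps * n of order ln r.
   Hence the caps on alpha and beta fixed before c in the theorem. *)
Definition sample_bound {R : realType} (d : nat) (k r eps alpha beta : R) : R :=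
  d%:R * ln (d%:R / beta) / alpha ^+ 2
  + d%:R * ln (d%:R / beta) / (eps * alpha `^ (k / (k - 1)))
  + d%:R * ln r * ln (d%:R / beta) / eps.

(* Main.v *)
From HB Require Import structures.
Require Import Defs.
From mathcomp Require Import ring lra zify.

(** The algorithm is a single exponential mechanism over a grid of spacing
    [alpha / (20 sqrt d)] covering the ball of radius [r].  A grid point [y] is
    penalised by the largest value, over a finite net of [(4 d + 1) ^ d] directions
    [v], of [|sum_i clip_T <x_i - y, v>|], where the truncation level
    [T ~ alpha ^ (- 1 / (k - 1))] makes the truncation bias at most [alpha / 40].
    Changing one sample moves the penalty by at most [2 T].

    Bernstein-type bounds are only needed at the true mean: with high probability,
    for every direction of the net, the truncated sum of [<x_i - mu, v>] is at most
    [n alpha / 20] and at least half of these projections are below [T / 2].  Since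
    [clip_T] is monotone and 1-Lipschitz, this alone forces the penalty of every [y]
    at distance [delta > alpha] from [mu] to exceed that of the grid point nearest to
    [mu] by [n min(delta, T) / 10], uniformly in [y].  The gap grows with [delta], so
    the bad grid points within distance [T] contribute a convergent product of
    geometric series, without any [ln (1 / alpha)] factor; for those beyond, the
    crude count of grid points is affordable because the gap is of order [n T]. *)

Set Implicit Arguments.
Unset Strict Implicit.
Unset Printing Implicit Defensive.

Import Order.TTheory GRing.Theory Num.Theory.
Import numFieldNormedType.Exports.

Local Open Scope classical_set_scope.
Local Open Scope ring_scope.

(** * Independence and the Chernoff bound *)

Section weighted_transfer.
Local Open Scope ereal_scope.
Context {dT dO : measure_display} {T : measurableType dT} {O : measurableType dO}.
Context {R : realType} (P : {measure set O -> \bar R}) (D : {measure set T -> \bar R}).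
Variables (X : {mfun O >-> T}) (Phi : O -> R) (C : \bar R).
Hypothesis mPhi : measurable_fun setT Phi.
Hypothesis Phi0 : forall w, (0 <= Phi w)%R.
Hypothesis Cfin : C \is a fin_num.
Hypothesis PhiE : forall A, measurable A ->
  \int[P]_w (Phi w * \1_A (X w))%:E = C * D A.

Import HBNNSimple.

Let transfer_nnsfun (h : {nnsfun T >-> R}) :
  \int[P]_w (Phi w * h (X w))%:E = C * \int[D]_x (h x)%:E.
Proof.
transitivity (\int[P]_w \sum_(r \in range h)
    (r%:E * (Phi w * \1_(h @^-1` [set r]) (X w))%:E)).
  apply: eq_integral => w _; rewrite {1}(fimfunE h) EFinM -fsumEFin//.
  rewrite ge0_mule_fsumr; last by move=> r; rewrite EFinM nnfun_muleindic_ge0.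
  by apply: eq_fsbigr => r _; rewrite -!EFinM mulrCA.
have mI r : measurable_fun setT (fun w => (Phi w * \1_(h @^-1` [set r]) (X w))%R).
  apply: measurable_funM => //.
  by apply: (measurableT_comp _ (measurable_funPT X)); exact: measurable_indic.
rewrite ge0_integral_fsum//; last 2 first.
  - by move=> r; apply: measurable_funeM; exact/measurable_EFinP.
  - move=> r w _; rewrite -EFinM mulrCA EFinM mule_ge0// ?lee_fin//.
    by have := nnfun_muleindic_ge0 h r (X w); rewrite lee_fin.
transitivity (\sum_(r \in range h) C * (r%:E * D (h @^-1` [set r]))).
  apply: eq_fsbigr => r; rewrite inE => -[x _ <-].
  rewrite ge0_integralZl//; last 3 first.
  - exact/measurable_EFinP.
  - by move=> w _; rewrite lee_fin mulr_ge0.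
  - by rewrite lee_fin.
  by rewrite PhiE// muleCA.
rewrite -ge0_mule_fsumr; last first.
  move=> r; have [r0|r0] := leP 0%R r; first by rewrite mule_ge0// lee_fin.
  by rewrite preimage_nnfun0// measure0 mule0.
by congr (C * _); rewrite integral_nnsfun// patch_setT sintegralE.
Qed.

(** [PhiE] is the case of an indicator. Linearity gives simple functions, and monotone convergence
    gives the rest. *)
Lemma weighted_transfer (h : T -> R) : measurable_fun setT h ->
    (forall x, (0 <= h x)%R) ->
  \int[P]_w (Phi w * h (X w))%:E = C * \int[D]_x (h x)%:E.
Proof.
move=> mh h0; have mEh : measurable_fun setT (EFin \o h) by exact/measurable_EFinP.
have Eh0 x : [set: T] x -> 0 <= (EFin \o h) x by rewrite lee_fin.
pose h_ := nnsfun_approx measurableT mEh.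
have h_cvg x : EFin \o h_^~ x @ \oo --> (h x)%:E.
  exact: (cvg_nnsfun_approx measurableT mEh Eh0 Logic.I).
have ndh x : {homo h_^~ x : m n / (m <= n)%N >-> (m <= n)%R}.
  by move=> m n mn; exact/lefP/nd_nnsfun_approx.
transitivity (limn (fun n => \int[P]_w (Phi w * h_ n (X w))%:E)).
  rewrite -monotone_convergence//=.
  - apply: eq_integral => w _; apply/esym/cvg_lim => //=.
    under eq_fun do rewrite EFinM.
    rewrite EFinM; apply: cvgeZl => //; exact: (h_cvg (X w)).
  - move=> n; apply/measurable_EFinP; apply: measurable_funM => //.
    exact: (measurableT_comp (measurable_funPT (h_ n)) (measurable_funPT X)).
  - by move=> n w _; rewrite lee_fin mulr_ge0.
  - by move=> w _ a b ab; rewrite lee_fin ler_wpM2l// ndh.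
rewrite (_ : \int[D]_x _ = limn (fun n => \int[D]_x (h_ n x)%:E)); last first.
  rewrite -monotone_convergence//=.
  - by apply: eq_integral => x _; apply/esym/cvg_lim => //; exact: h_cvg.
  - by move=> n; exact/measurable_EFinP.
  - by move=> n x _; rewrite lee_fin.
  - by move=> x _ a b ab; rewrite lee_fin ndh.
rewrite -limeMl//; last first.
  apply/ereal_nondecreasing_is_cvgn => a b ab; apply: ge0_le_integral => //.
  - by move=> x _; rewrite lee_fin.
  - exact/measurable_EFinP.
  - exact/measurable_EFinP.
  - by move=> x _; rewrite lee_fin ndh.
by congr (limn _); apply/funext => n; rewrite transfer_nnsfun.

Qed.

End weighted_transfer.

Section iid_samples.
Local Open Scope ereal_scope.
Context {dT dO : measure_display} {T : measurableType dT} {O : measurableType dO}.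
Context {R : realType} (P : probability O R) (D : probability T R).

(** [iid] speaks of events only; this passes to functions. The integrals must be finite because the
    product of the other factors enters [weighted_transfer] as a finite constant. *)
Lemma iid_integral_prod (n : nat) (X : 'I_n -> {mfun O >-> T}) (h : 'I_n -> T -> R) :
  iid P X D ->
  (forall i, measurable_fun setT (h i)) -> (forall i x, (0 <= h i x)%R) ->
  (forall i, \int[D]_x (h i x)%:E < +oo) ->
  \int[P]_w (\prod_(i < n) h i (X i w))%:E = \prod_(i < n) \int[D]_x (h i x)%:E.
Proof.
move=> [indX distX].
(* One factor at a time is freed from being an indicator function. *)
suff claim j : forall g : 'I_n -> T -> R, (forall i, measurable_fun setT (g i)) ->
    (forall i x, (0 <= g i x)%R) -> (forall i, \int[D]_x (g i x)%:E < +oo) ->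
    (forall i : 'I_n, (j <= i)%N -> exists2 A, measurable A & g i = \1_A) ->
    \int[P]_w (\prod_(i < n) g i (X i w))%:E = \prod_(i < n) \int[D]_x (g i x)%:E.
  move=> mh h0 hoo; apply: (claim n) => // i; by rewrite leqNgt ltn_ord.
elim: j => [|j IH] g mg g0 goo gind.
  have /choice[A AP] : forall i, exists A, measurable A /\ g i = \1_A.
    by move=> i; have [//|A mA gA] := gind i; exists A.
  have -> : (fun w => (\prod_(i < n) g i (X i w))%:E) =
            (fun w => (\1_(\bigcap_(i in [set` [set: 'I_n]%SET]) (X i @^-1` A i)) w)%:E).
    apply/funext => w; congr (_%:E); rewrite indicE.
    case: (boolP (w \in _)) => [/set_mem wA|/negP wA].
      rewrite big1// => i _; rewrite (AP i).2 indicE mem_set//.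
      by apply: wA; rewrite /= inE.
    have [i wi] : exists i, ~ A i (X i w).
      apply: contra_notP wA => /forallNP wA; apply/mem_set => i _ /=.
      exact: contrapT (wA i).
    by rewrite (bigD1 i)//= (AP i).2 indicE memNset// mul0r.
  rewrite integral_indic//; last first.
    apply: fin_bigcap_measurable => [|i _]; first exact: finite_finset.
    rewrite -[_ @^-1` _]setTI; exact: (measurable_funPT (X i) measurableT _ (AP i).1).
  rewrite setIT.
  transitivity (\prod_(i in [set: 'I_n]%SET) P (X i @^-1` A i)).
    by apply: indX => i; exact: (AP i).1.
  rewrite big_mkcond/=; apply: eq_bigr => i _; rewrite inE.
  have [mA ->] := AP i.
  rewrite integral_indic// setIT; exact: (distX i _ mA).
(* When [n <= j] no index is left on which an indicator would be required. *)
have [jn|nj] := ltnP j n; last first.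
  by apply: IH => // i ji; move: (leq_ltn_trans ji (ltn_ord i)); rewrite ltnNge nj.
pose j0 := Ordinal jn.
rewrite (bigD1 j0)//= muleC.
under eq_integral do rewrite (bigD1 j0)//= mulrC.
apply: (weighted_transfer (Phi := fun w => (\prod_(i < n | i != j0) g i (X i w))%R)).
- under eq_fun do rewrite -big_filter.
  apply: measurable_prod => i _.
  exact: (measurableT_comp (mg i) (measurable_funPT (X i))).
- by move=> w; apply: prodr_ge0 => i _; exact: g0.
- apply: prode_fin_num => i _; rewrite ge0_fin_numE//.
  by apply: integral_ge0 => x _; rewrite lee_fin; exact: g0.
(* With the factor at [j0] replaced by an indicator, the family falls under the induction
   hypothesis. *)
- move=> A mA; pose g' i := if i == j0 then \1_A else g i.
  have g'j : g' j0 = \1_A by rewrite /g' eqxx.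
  have g'i i : i != j0 -> g' i = g i by rewrite /g' => /negbTE ->.
  transitivity (\int[P]_w (\prod_(i < n) g' i (X i w))%:E).
    apply: eq_integral => w _; rewrite [in RHS](bigD1 j0)//= g'j mulrC.
    by congr ((_ * _)%:E); apply: eq_bigr => i ij; rewrite g'i.
  rewrite IH.
  + rewrite (bigD1 j0)//= g'j integral_indic// setIT muleC; congr (_ * _).
    by apply: eq_bigr => i ij; rewrite g'i.
  + by move=> i; rewrite /g'; case: ifP => // _; exact: measurable_indic.
  + by move=> i x; rewrite /g'; case: ifP => // _; rewrite indicE.
  + move=> i; rewrite /g'; case: ifP => // _; rewrite integral_indic// setIT.
    by rewrite (le_lt_trans (probability_le1 _ _))// ltry.
  + move=> i ji; rewrite /g'; case: eqVneq => [_|ij]; first by exists A.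
    apply: gind; rewrite ltn_neqAle ji andbT; apply: contra_neq ij => ji'.
    exact/val_inj.
- exact: mg.
- exact: g0.
Qed.

Lemma measurable_sample_sum_ge (n : nat) (X : 'I_n -> {mfun O >-> T}) (f : T -> R) (t : R) :
  measurable_fun setT f -> measurable [set w | (t <= \sum_(i < n) f (X i w))%R].
Proof.
move=> mf; have mS : measurable_fun setT (fun w => \sum_(i < n) f (X i w))%R.
  by apply: measurable_sum => i; exact: (measurableT_comp mf (measurable_funPT (X i))).
have -> : [set w | (t <= \sum_(i < n) f (X i w))%R] =
    setT `&` (fun w => \sum_(i < n) f (X i w))%R @^-1` `[t, +oo[%classic.
  by apply/seteqP; split => w; rewrite /= in_itv/= andbT => // -[].
by apply: mS => //; exact: measurable_itv.
Qed.

(** Markov's inequality for the exponential of the sum, whose expectation factorises. The Chernoff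
    parameter is already absorbed in [f] and [t]. *)
Lemma iid_chernoff (n : nat) (X : 'I_n -> {mfun O >-> T}) (f : T -> R) (s t : R) :
  iid P X D -> measurable_fun setT f ->
  \int[D]_x (expR (f x))%:E <= (expR s)%:E ->
  P [set w | (t <= \sum_(i < n) f (X i w))%R] <= (expR (n%:R * s - t))%:E.
Proof.
move=> iidX mf fs.
have mS : measurable_fun setT (fun w => \sum_(i < n) f (X i w))%R.
  by apply: measurable_sum => i; exact: (measurableT_comp mf (measurable_funPT (X i))).
have mE : measurable_fun setT (fun w => expR (\sum_(i < n) f (X i w) - t)).
  by apply: measurableT_comp => //; apply: measurable_funB.
set E := [set w | _].
have mEE : measurable E by exact: measurable_sample_sum_ge.
rewrite -(setIT E) -(integral_indic _ measurableT)//.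
apply: (@le_trans _ _ (\int[P]_w (expR (- t) * \prod_(i < n) expR (f (X i w)))%:E)).
  have eqF w : (expR (- t) * \prod_(i < n) expR (f (X i w)) =
      expR (\sum_(i < n) f (X i w) - t))%R.
    by rewrite addrC expRD expR_sum.
  apply: ge0_le_integral => //.
  - exact/measurable_EFinP.
  - by apply/measurable_EFinP; under eq_fun do rewrite eqF.
  - move=> w _; rewrite lee_fin eqF indicE; case: (boolP (w \in E)) => [/set_mem|_].
      by rewrite /E /= => tS; rewrite -expR0 ler_expR subr_ge0.
    exact: expR_ge0.
under eq_integral do rewrite EFinM.
have mp : measurable_fun setT (fun w => (\prod_(i < n) expR (f (X i w)))%R).
  apply: measurable_prod => i _; apply: measurableT_comp => //.
  exact: (measurableT_comp mf (measurable_funPT (X i))).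
rewrite ge0_integralZl//; last 2 first.
- exact/measurable_EFinP.
- by move=> w _; rewrite lee_fin; apply: prodr_ge0 => i _; exact: expR_ge0.
rewrite (@iid_integral_prod n X (fun _ x => expR (f x)))//; last 2 first.
- by move=> i; exact: measurableT_comp.
- by move=> _; rewrite (le_lt_trans fs)// ltry.
rewrite addrC expRD EFinM lee_pmul2l// ?lte_fin ?expR_gt0//.
have prod_le m : \prod_(i < m) \int[D]_x (expR (f x))%:E <= (expR s ^+ m)%:E.
  elim: m => [|m IHm]; first by rewrite big_ord0 expr0.
  rewrite big_ord_recr/= exprSr EFinM lee_pmul//.
  - by apply: prode_ge0 => i _; apply: integral_ge0 => x _; rewrite lee_fin expR_ge0.
  - by apply: integral_ge0 => x _; rewrite lee_fin expR_ge0.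
by rewrite expRM_natl; exact: prod_le.
Qed.

End iid_samples.

(** * Euclidean vectors, truncation and moments *)

Section euclidean_theory.
Context {R : realType} {d : nat}.
Implicit Types x y v : d.-tuple R.

Lemma tnth_subt x y i : tnth (subt x y) i = tnth x i - tnth y i.
Proof. by rewrite tnth_mktuple. Qed.

Lemma dot_subt x y v : dot (subt x y) v = dot x v - dot y v.
Proof.
rewrite /dot -sumrB; apply: eq_bigr => i _.
by rewrite tnth_subt mulrBl.
Qed.

Lemma norm2_ge0 x : 0 <= norm2 x.
Proof. exact: sqrtr_ge0. Qed.

Lemma dotxx_ge0 x : 0 <= dot x x.
Proof. by apply: sumr_ge0 => i _; rewrite -expr2 sqr_ge0. Qed.

Lemma sqr_norm2 x : norm2 x ^+ 2 = dot x x.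
Proof. by rewrite /norm2 sqr_sqrtr// dotxx_ge0. Qed.

Lemma normr_tnth_le_norm2 x i : `|tnth x i| <= norm2 x.
Proof.
rewrite -(@ler_pXn2r _ 2)// ?nnegrE ?norm2_ge0// sqr_norm2 real_normK ?num_real//.
rewrite /dot (bigD1 i)//= -expr2 lerDl.
by apply: sumr_ge0 => j _; rewrite -expr2 sqr_ge0.
Qed.

(** Cauchy-Schwarz: with [A = norm2 x] and [B = norm2 y], the sum of the squares of [A y_i - B x_i]
    equals [2 A B (A B - dot x y)]. *)
Lemma dot_le_norm2 x y : dot x y <= norm2 x * norm2 y.
Proof.
have [x0|x0] := eqVneq (norm2 x) 0.
  rewrite x0 mul0r /dot big1// => i _.
  have := normr_tnth_le_norm2 x i; rewrite x0 normr_le0 => /eqP ->.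
  by rewrite mul0r.
have [y0|y0] := eqVneq (norm2 y) 0.
  rewrite y0 mulr0 /dot big1// => i _.
  have := normr_tnth_le_norm2 y i; rewrite y0 normr_le0 => /eqP ->.
  by rewrite mulr0.
have xy0 : 0 < norm2 x * norm2 y.
  by rewrite mulr_gt0 // lt_neqAle eq_sym ?x0 ?y0 norm2_ge0.
rewrite -(ler_pM2l xy0).
have : 0 <= \sum_(i < d) (norm2 x * tnth y i - norm2 y * tnth x i) ^+ 2.
  by apply: sumr_ge0 => i _; exact: sqr_ge0.
have -> : \sum_(i < d) (norm2 x * tnth y i - norm2 y * tnth x i) ^+ 2 =
    norm2 x ^+ 2 * dot y y + norm2 y ^+ 2 * dot x x
    - 2 * (norm2 x * norm2 y) * dot x y.
  rewrite /dot !mulr_sumr -big_split/= -sumrB; apply: eq_bigr => i _; ring.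
rewrite -!sqr_norm2; set A := norm2 x; set B := norm2 y; set s := dot x y.
nra.
Qed.

Definition oppt y : d.-tuple R := [tuple - tnth y i | i < d].

Lemma dot_oppt x y : dot x (oppt y) = - dot x y.
Proof. by rewrite /dot -sumrN; apply: eq_bigr => i _; rewrite tnth_mktuple mulrN. Qed.

Lemma norm2_oppt y : norm2 (oppt y) = norm2 y.
Proof.
by congr Num.sqrt; apply: eq_bigr => i _; rewrite tnth_mktuple mulrNN.
Qed.

Lemma normr_dot_le_norm2 x y : `|dot x y| <= norm2 x * norm2 y.
Proof.
by rewrite ler_norml dot_le_norm2 andbT lerNl -dot_oppt -(norm2_oppt y) dot_le_norm2.
Qed.

(** Cauchy-Schwarz against the vector of signs of [x]. *)
Lemma norm1_le_norm2 x : \sum_(i < d) `|tnth x i| <= Num.sqrt d%:R * norm2 x.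
Proof.
pose s : d.-tuple R := [tuple Num.sg (tnth x i) | i < d].
have si i : tnth s i = Num.sg (tnth x i) by rewrite tnth_mktuple.
have -> : \sum_(i < d) `|tnth x i| = dot s x.
  by apply: eq_bigr => i _; rewrite si normrEsg.
rewrite (le_trans (dot_le_norm2 _ _))// ler_wpM2r ?norm2_ge0//.
rewrite ler_sqrt ?ler0n// /dot -[X in _ <= X%:R]card_ord -sumr_const.
apply: ler_sum => i _; rewrite si -expr2 sqr_sg.
by case: (_ != 0).
Qed.

Lemma norm2_le_bound x (b : R) : 0 <= b -> (forall i, `|tnth x i| <= b) ->
  norm2 x <= Num.sqrt d%:R * b.
Proof.
move=> b0 xb; rewrite -(@ler_pXn2r _ 2)// ?nnegrE ?norm2_ge0//; last first.
  by rewrite mulr_ge0// sqrtr_ge0.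
rewrite sqr_norm2 exprMn sqr_sqrtr ?ler0n// /dot.
rewrite (le_trans (y := \sum_(i < d) b ^+ 2))//.
  apply: ler_sum => i _; rewrite -expr2 -real_normK ?num_real//.
  by rewrite ler_pXn2r// ?nnegrE.
by rewrite sumr_const card_ord mulr_natl.
Qed.

Lemma measurable_dot v : measurable_fun setT (fun x => dot x v).
Proof.
apply: measurable_sum => i; apply: measurable_funM => //.
exact: measurable_tnth.
Qed.

Lemma measurable_dot_subt y v : measurable_fun setT (fun x => dot (subt x y) v).
Proof.
under eq_fun do rewrite dot_subt.
by apply: measurable_funB => //; exact: measurable_dot.
Qed.

Lemma measurable_norm2_subt y : measurable_fun setT (fun x => norm2 (subt y x)).
Proof.
rewrite /norm2 (_ : (fun x => _) = (fun x => dot (subt y x) (subt y x) `^ 2^-1)).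
  apply: (measurableT_comp (f := @powR R ^~ 2^-1)); first exact: measurable_powR.
  rewrite /dot; apply: measurable_sum => i; under eq_fun do rewrite tnth_subt.
  by apply: measurable_funM; apply: measurable_funB => //; exact: measurable_tnth.
by apply/funext => x; rewrite powR12_sqrt// dotxx_ge0.
Qed.

End euclidean_theory.

(** * Truncation and pointwise exponential bounds *)

Section clip.
Context {R : realType}.
Implicit Types T z s : R.

Definition clip T z : R := Num.max (- T) (Num.min T z).

(** In each case [clip] is affine, so the facts below reduce to linear arithmetic. *)
Lemma clipP T z : 0 <= T ->
  [\/ (z <= - T) /\ (clip T z = - T), (- T <= z /\ z <= T) /\ (clip T z = z)
   | (T <= z) /\ (clip T z = T)].
Proof.
move=> T0; rewrite /clip; case: (leP T z) => Tz.
  by rewrite max_r; [constructor 3|lra].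
by case: (leP (- T) z) => zT; [constructor 2; split; lra|constructor 1; split; lra].
Qed.

Lemma clip_le T z : 0 <= T -> `|clip T z| <= T.
Proof.
move=> T0; rewrite ler_norml.
by have [[? ->]|[[? ?] ->]|[? ->]] := clipP z T0; lra.
Qed.

Lemma clip_lipschitz T z s : 0 <= T -> `|clip T (z + s) - clip T z| <= `|s|.
Proof.
move=> T0; rewrite ler_norml.
have := ler_norm s; have := ler_norm (- s); rewrite normrN => h1 h2.
by have [[? ->]|[[? ?] ->]|[? ->]] := clipP (z + s) T0;
  have [[? ->]|[[? ?] ->]|[? ->]] := clipP z T0; lra.
Qed.

Lemma clip_homo T z s : 0 <= T -> 0 <= s -> clip T z <= clip T (z + s).
Proof.
move=> T0 s0.
by have [[? ->]|[[? ?] ->]|[? ->]] := clipP (z + s) T0;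
  have [[? ->]|[[? ?] ->]|[? ->]] := clipP z T0; lra.
Qed.

Lemma clip_add T z s : `|z| <= T / 2 -> 0 <= s <= T / 2 -> clip T (z + s) = clip T z + s.
Proof.
rewrite ler_norml => /andP[? ?] /andP[? ?]; have T0 : 0 <= T by lra.
by have [[? ->]|[[? ?] ->]|[? ->]] := clipP (z + s) T0;
  have [[? ->]|[[? ?] ->]|[? ->]] := clipP z T0; lra.
Qed.

Lemma clipN T z : 0 <= T -> clip T (- z) = - clip T z.
Proof.
move=> T0; have [[? ->]|[[? ?] ->]|[? ->]] := clipP (- z) T0;
  by have [[? ->]|[[? ?] ->]|[? ->]] := clipP z T0; lra.
Qed.

Lemma measurable_clip T : measurable_fun setT (clip T).
Proof. by apply: measurable_maxr => //; exact: measurable_minr. Qed.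

(** [expR x <= (1 - x)^-1], and the quadratic times [1 - x] exceeds 1 by [x ^+ 2 * (1 - 2 * x)]. *)
Lemma expR_le_quadratic (x : R) : x <= 1 / 2 -> expR x <= 1 + x + 2 * x ^+ 2.
Proof.
move=> x12; have x1 : 0 < 1 - x by lra.
have := expR_ge1Dx (- x); rewrite expRN => h.
rewrite (@le_trans _ _ ((1 - x)^-1))//.
  by rewrite -[expR x]invrK lef_pV2 ?posrE ?invr_gt0 ?expR_gt0.
rewrite -div1r ler_pdivrMr//.
rewrite -subr_ge0 (_ : _ - 1 = x ^+ 2 * (1 - 2 * x)); last by ring.
by rewrite mulr_ge0 ?sqr_ge0//; lra.
Qed.

Lemma sqr_le_1_powR (k z : R) : 2 <= k -> z ^+ 2 <= 1 + `|z| `^ k.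
Proof.
move=> k2; rewrite -real_normK ?num_real//; have [z1|z1] := leP `|z| 1.
  by rewrite (@le_trans _ _ 1)// ?exprn_ile1// lerDl powR_ge0.
rewrite -powR_mulrn//; apply: (@le_trans _ _ (`|z| `^ k)); last by rewrite lerDr.
exact: ler_powR (ltW z1) _ _ k2.
Qed.

(** The right-hand side is affine in [z] and [|z| ^ k], the two quantities whose expectations are
    controlled. *)
Lemma expR_clip_le (k T l z : R) : 2 <= k -> 0 < T -> 0 <= l -> l * T <= 1 / 2 ->
  expR (l * clip T z) <=
    (1 + 2 * l ^+ 2) + l * z + (l * T `^ (1 - k) + 2 * l ^+ 2) * `|z| `^ k.
Proof.
move=> k2 T0 l0 lT.
have cT := clip_le z (ltW T0).
have lc : l * clip T z <= 1 / 2.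
  by rewrite (le_trans _ lT)// ler_wpM2l// (le_trans (ler_norm _)).
rewrite (le_trans (expR_le_quadratic lc))//.
have c2 : clip T z ^+ 2 <= 1 + `|z| `^ k.
  rewrite (le_trans _ (sqr_le_1_powR z k2))//.
  rewrite -real_normK ?num_real// -[leRHS]real_normK ?num_real// ler_pXn2r// ?nnegrE//.
  have := clip_lipschitz 0 z (ltW T0); rewrite add0r.
  suff -> : clip T 0 = 0 by rewrite subr0.
  by have [[? ->]|[[? ?] ->]|[? ->]] := clipP 0 (ltW T0); lra.
(* Clipping raises [z] only below [- T]; there [clip T z <= 0], and [T <= |z|] makes the added term
   at least [|z|]. *)
have c1 : clip T z <= z + T `^ (1 - k) * `|z| `^ k.
  have [Tz|zT] := leP (- T) z.
    rewrite (@le_trans _ _ z)//; last by rewrite lerDl mulr_ge0 ?powR_ge0.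
    by have [[? ->]|[[? ?] ->]|[? ->]] := clipP z (ltW T0); lra.
  rewrite (@le_trans _ _ 0)//.
    by have [[? ->]|[[? ?] ->]|[? ->]] := clipP z (ltW T0); lra.
  have Tz : T <= `|z| by rewrite ltr0_norm; lra.
  rewrite -lerBlDl sub0r -ler0_norm; last lra.
  rewrite -(mulr_powRB1 (normr_ge0 z)); last lra.
  rewrite mulrCA ler_peMr// -(opprB k 1) powRN mulrC ler_pdivlMr ?powR_gt0// mul1r.
  by apply: ge0_ler_powR; rewrite ?nnegrE; lra.
have := ler_wpM2l l0 c1; have l20 : 0 <= 2 * l ^+ 2 by rewrite mulr_ge0// sqr_ge0.
have := ler_wpM2l l20 c2; rewrite exprMn; lra.
Qed.

(* The factor [1 / 2] keeps [expR (half_tail T z) <= 1 + (T / 2 < |z|)] elementary. *)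
Definition half_tail T z : R := 2^-1 * (T / 2 < `|z|)%R%:R.

(** A Chebyshev argument: for [|z| > T / 2] the left side is at most 2 and [4 / T ^+ 2 * z ^+ 2] is
    at least 1. The null term in [z] fits the shape of [integral_le_moment]. *)
Lemma expR_tail_le (k T z : R) : 2 <= k -> 0 < T ->
  expR (half_tail T z) <= (1 + 4 / T ^+ 2) + 0 * z + 4 / T ^+ 2 * `|z| `^ k.
Proof.
move=> k2 T0; have T20 : 0 <= 4 / T ^+ 2 by rewrite divr_ge0// sqr_ge0.
have zk := sqr_le_1_powR z k2; rewrite mul0r addr0.
rewrite /half_tail; case: ltP => zT; last first.
  by rewrite mulr0 expR0 -addrA lerDl addr_ge0// mulr_ge0// powR_ge0.
rewrite mulr1 (@le_trans _ _ 2)//.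
  have : (2^-1 : R) <= 1 / 2 by lra.
  by move/expR_le_quadratic => h; rewrite (le_trans h)//; lra.
have := ler_wpM2l T20 zk; rewrite mulrDr mulr1.
suff : 1 <= 4 / T ^+ 2 * z ^+ 2 by lra.
rewrite mulrAC ler_pdivlMr ?exprn_gt0// mul1r -[z ^+ 2]real_normK ?num_real//.
have z0 := normr_ge0 z; nra.
Qed.

End clip.

(** * Expectations along one direction *)

Section moments.
Context {R : realType} {d : nat} (D : probability (d.-tuple R) R).
Variables (mu : d.-tuple R) (k : R).
Hypothesis k2 : 2 <= k.
Hypothesis Dmean : has_mean D mu.
Hypothesis Dmoment : central_moment_le1 D mu k.

Let Z v (x : d.-tuple R) : R := dot (subt x mu) v.

Lemma measurable_abs_moment v : measurable_fun setT (fun x => `|Z v x| `^ k).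
Proof.
apply: (measurableT_comp (f := @powR R ^~ k)); first exact: measurable_powR.
by apply: measurableT_comp => //; exact: measurable_dot_subt.
Qed.

(** By homogeneity the moment bound passes from unit vectors to the unit ball, where the net of
    directions lives. *)
Lemma moment_le1 v : norm2 v <= 1 -> (\int[D]_x (`|Z v x| `^ k)%:E <= 1)%E.
Proof.
move=> v1; have [v0|v0] := eqVneq (norm2 v) 0.
  rewrite (eq_integral (cst 0%E)) ?integral0// => x _ /=.
  suff -> : Z v x = 0 by rewrite normr0 powR0 ?gt_eqF // (lt_le_trans _ k2).
  apply: big1 => i _; have := normr_tnth_le_norm2 v i.
  by rewrite v0 normr_le0 => /eqP ->; rewrite mulr0.
have vp : 0 < norm2 v by rewrite lt_neqAle eq_sym v0 norm2_ge0.
pose w : d.-tuple R := [tuple tnth v i / norm2 v | i < d].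
have wi i : tnth w i = tnth v i / norm2 v by rewrite tnth_mktuple.
have w1 : norm2 w = 1.
  apply/eqP; rewrite -(@eqrXn2 _ 2)// ?norm2_ge0// expr1n sqr_norm2 /dot.
  under eq_bigr do rewrite !wi mulrACA -invfM.
  by rewrite -mulr_suml -/(dot v v) -sqr_norm2 -expr2 divff// sqrf_eq0.
have Zw x : Z v x = norm2 v * Z w x.
  rewrite /Z /dot mulr_sumr; apply: eq_bigr => i _.
  by rewrite wi; field.
have := Dmoment w1; rewrite unlock; apply: le_trans; apply: ge0_le_integral => //.
- by apply/measurable_EFinP; exact: measurable_abs_moment.
- by apply/measurable_EFinP; exact: measurable_abs_moment.
- move=> x _; rewrite lee_fin; apply: ge0_ler_powR; rewrite ?nnegrE//.
    by rewrite (le_trans _ k2).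
  by rewrite Zw normrM ger0_norm ?norm2_ge0// ler_piMl.
Qed.

Lemma integrable_moment v : norm2 v <= 1 ->
  D.-integrable setT (EFin \o (fun x => `|Z v x| `^ k)).
Proof.
move=> v1; apply/integrableP; split.
  by apply/measurable_EFinP; exact: measurable_abs_moment.
under eq_integral do rewrite /= ger0_norm ?powR_ge0//.
by rewrite (le_lt_trans (moment_le1 v1))// ltry.
Qed.

Let integrable_coord i (c : R) :
  D.-integrable setT (EFin \o (fun x => (tnth x i - tnth mu i) * c)).
Proof.
rewrite (_ : _ \o _ = (fun x => c%:E * ((EFin \o (fun x => tnth x i)) x - (tnth mu i)%:E)))%E.
  apply: integrableZl => //; apply: integrableB => //.
    exact: (Dmean i).1.
  exact: finite_measure_integrable_cst.
by apply/funext => x /=; rewrite mulrC EFinM EFinB.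
Qed.

Let integral_coord i (c : R) :
  (\int[D]_x (EFin \o (fun x => ((tnth x i - tnth mu i) * c)%R)) x = 0)%E.
Proof.
have [Di Ei] := Dmean i.
have icst : D.-integrable setT (cst (tnth mu i)%:E).
  exact: finite_measure_integrable_cst.
transitivity (\int[D]_x (c%:E * ((EFin \o (fun x => tnth x i)) x - (cst (tnth mu i)%:E) x)))%E.
  by apply: eq_integral => x _ /=; rewrite mulrC EFinM EFinB.
rewrite integralZl//; last exact: integrableB.
rewrite integralB// integral_cst//.
rewrite [X in (_ - _ * X)%E](_ : _ = 1%E) ?mule1; last exact: probability_setT.
move: Ei; rewrite unlock => ->.
by rewrite subee// mule0.
Qed.

Let dotE v : EFin \o Z v =
  (fun x => \sum_(i < d) (EFin \o (fun x => ((tnth x i - tnth mu i) * tnth v i)%R)) x)%E.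
Proof.
apply/funext => x /=; rewrite sumEFin /Z /dot; congr EFin.
by apply: eq_bigr => i _; rewrite tnth_subt.
Qed.

Lemma integrable_dot v : D.-integrable setT (EFin \o Z v).
Proof. rewrite dotE; apply: integrable_sum => // i _; exact: integrable_coord. Qed.

Lemma integral_dot v : (\int[D]_x (EFin \o Z v) x = 0)%E.
Proof.
rewrite dotE integral_sum//.
by rewrite big1// => i _; exact: integral_coord.
Qed.

(** The linear term integrates to 0 because [mu] is the mean, and the last one to at most [c]. *)
Lemma integral_le_moment v (F : d.-tuple R -> R) (a b c : R) : norm2 v <= 1 ->
  measurable_fun setT F -> (forall x, 0 <= F x) -> 0 <= c ->
  (forall x, F x <= a + b * Z v x + c * `|Z v x| `^ k) ->
  (\int[D]_x (F x)%:E <= (a + c)%:E)%E.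
Proof.
move=> v1 mF F0 c0 Fle.
have ia : D.-integrable setT (cst a%:E) by exact: finite_measure_integrable_cst.
have ib : D.-integrable setT (fun x => b%:E * (EFin \o Z v) x)%E.
  by apply: integrableZl => //; exact: integrable_dot.
have ic : D.-integrable setT (fun x => c%:E * (EFin \o (fun x => (`|Z v x| `^ k)%R)) x)%E.
  by apply: integrableZl => //; exact: integrable_moment.
have iab : D.-integrable setT (fun x => (cst a%:E) x + b%:E * (EFin \o Z v) x)%E.
  exact: integrableD.
apply: (@le_trans _ _ (\int[D]_x (((cst a%:E) x + b%:E * (EFin \o Z v) x)
    + c%:E * (EFin \o (fun x => (`|Z v x| `^ k)%R)) x))%E).
  apply: ge0_le_integral => //.
  - by move=> x _; rewrite lee_fin.
  - exact/measurable_EFinP.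
  - by have /measurable_int := integrableD measurableT iab ic.
  - by move=> x _; rewrite /= -!EFinM -!EFinD lee_fin.
rewrite integralD// integralD// integral_cst//.
rewrite [X in (_ * X + _ + _)%E](_ : _ = 1%E) ?mule1; last exact: probability_setT.
rewrite integralZl//; last exact: integrable_dot.
rewrite integral_dot mule0 adde0 integralZl//; last exact: integrable_moment.
rewrite EFinD leeD2l// -[leRHS]mule1.
by apply: lee_wpmul2l; [rewrite lee_fin|exact: moment_le1].
Qed.

Lemma integral_expR_clip v T l : norm2 v <= 1 -> 0 < T -> 0 <= l -> l * T <= 1 / 2 ->
  (\int[D]_x (expR (l * clip T (Z v x)))%:E <=
   (expR (l * T `^ (1 - k) + 4 * l ^+ 2))%:E)%E.
Proof.
move=> v1 T0 l0 lT.
apply: (@le_trans _ _ ((1 + 2 * l ^+ 2) + (l * T `^ (1 - k) + 2 * l ^+ 2))%:E).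
  apply: (integral_le_moment (v := v) (b := l)) => //.
  - apply: measurableT_comp => //; apply: measurable_funM => //.
    by apply: (measurableT_comp (measurable_clip T)); exact: measurable_dot_subt.
  - by rewrite addr_ge0// mulr_ge0// ?powR_ge0// sqr_ge0.
  - by move=> x; exact: expR_clip_le.
rewrite lee_fin (le_trans _ (expR_ge1Dx _))//; lra.
Qed.

Lemma measurable_half_tail v T :
  measurable_fun setT (fun x => half_tail T (Z v x)).
Proof.
apply: measurable_funM => //.
apply: (measurableT_comp (f := fun b : bool => b%:R : R)) => //.
apply: measurable_fun_ltr => //.
by apply: measurableT_comp => //; exact: measurable_dot_subt.
Qed.

Lemma integral_expR_tail v T : norm2 v <= 1 -> 0 < T ->
  (\int[D]_x (expR (half_tail T (Z v x)))%:E <= (expR (8 / T ^+ 2))%:E)%E.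
Proof.
move=> v1 T0.
apply: (@le_trans _ _ ((1 + 4 / T ^+ 2) + 4 / T ^+ 2)%:E).
  apply: (integral_le_moment (v := v) (b := 0)) => //.
  - by apply: measurableT_comp => //; exact: measurable_half_tail.
  - by rewrite divr_ge0// sqr_ge0.
  - by move=> x; exact: expR_tail_le.
rewrite lee_fin (le_trans _ (expR_ge1Dx _))//; lra.
Qed.

End moments.

(** * The exponential mechanism *)

Section exponential_mechanism.
Context {dX dY : measure_display} {X : measurableType dX} {Y : measurableType dY}.
Context {R : realType} {I : finType}.
Variables (i0 : I) (y : I -> Y) (u : I -> {mfun X >-> R}).

Definition emech_norm (x : X) : R := \sum_(i : I) expR (u i x).

Lemma emech_norm_gt0 x : 0 < emech_norm x.
Proof.
rewrite /emech_norm (bigD1 i0)//= ltr_wpDr ?expR_gt0//.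
by apply: sumr_ge0 => i _; exact: expR_ge0.
Qed.

Definition emech_weight (x : X) (i : I) : R := expR (u i x) / emech_norm x.

Lemma emech_weight_ge0 x i : 0 <= emech_weight x i.
Proof. by rewrite divr_ge0 ?expR_ge0// ltW// emech_norm_gt0. Qed.

Lemma sum_emech_weight x : \sum_i emech_weight x i = 1.
Proof. by rewrite -mulr_suml divff// gt_eqF// emech_norm_gt0. Qed.

(** A finite mixture of Dirac masses at the points [y i]. [i0] is the default of [nth]; it also
    witnesses that [I] is inhabited, hence that the normalisation is positive. *)
Definition emech (x : X) : {measure set Y -> \bar R} :=
  msum (fun k => mscale (NngNum (emech_weight_ge0 x (nth i0 (enum I) k)))
                   (dirac (y (nth i0 (enum I) k)))) (size (enum I)).

Lemma emechE x A : emech x A = (\sum_i emech_weight x i * \1_A (y i))%:E.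
Proof.
rewrite -sumEFin -big_enum/= (big_nth i0) big_mkord.
by apply: eq_bigr.
Qed.

Lemma measurable_emech_weight i : measurable_fun setT (emech_weight^~ i).
Proof.
have mn : measurable_fun setT emech_norm.
  by apply: measurable_sum => j; apply: measurableT_comp.
apply: measurable_funM; first exact: measurableT_comp.
rewrite (_ : (fun x => _) = (fun x => emech_norm x `^ (-1))); last first.
  by apply/funext => x; rewrite powR_inv1// ltW// emech_norm_gt0.
by apply: (measurableT_comp (f := @powR R ^~ (-1))) => //; exact: measurable_powR.
Qed.

Let measurable_emech U : measurable U -> measurable_fun setT (emech ^~ U).
Proof.
move=> mU; under eq_fun do rewrite emechE.
apply/measurable_EFinP; apply: measurable_sum => i.
by apply: measurable_funM => //; exact: measurable_emech_weight.
Qed.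

HB.instance Definition _ := isKernel.Build _ _ X Y R emech measurable_emech.

Let emechT x : emech x setT = 1%E.
Proof.
rewrite emechE; under eq_bigr do rewrite indicT mulr1.
by rewrite sum_emech_weight.
Qed.

HB.instance Definition _ := Kernel_isProbability.Build _ _ X Y R emech emechT.

Definition exponential_kernel : R.-pker X ~> Y := emech.

(** The weight of a point and the normalisation each cost a factor [expR (e / 2)]. *)
Lemma exponential_kernel_close (e : R) x x' A :
  (forall i, `|u i x - u i x'| <= e / 2) ->
  (exponential_kernel x A <= (expR e)%:E * exponential_kernel x' A)%E.
Proof.
move=> uxx'; rewrite /exponential_kernel !emechE -EFinM lee_fin mulr_sumr.
apply: ler_sum => i _; rewrite mulrA ler_wpM2r// ?indicE//.
have expu j z z' : `|u j z - u j z'| <= e / 2 ->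
    expR (u j z) <= expR (e / 2) * expR (u j z').
  by rewrite -expRD ler_expR ler_norml => /andP[_]; rewrite lerBlDr.
rewrite /emech_weight ler_pdivrMr ?emech_norm_gt0//.
rewrite (le_trans (expu i x x' (uxx' i)))// [e in leRHS]splitr expRD.
rewrite -!mulrA ler_pM2l ?expR_gt0//.
rewrite mulrCA ler_peMr ?expR_ge0//.
rewrite (mulrC _^-1) mulrA ler_pdivlMr ?emech_norm_gt0// mul1r /emech_norm mulr_sumr.
by apply: ler_sum => j _; apply: expu; rewrite distrC.
Qed.

(** The normalisation is at least [expR (u j x)], so each point outside [A] has weight at most
    [expR (u i x - u j x)]. *)
Lemma exponential_kernel_utility (j : I) x (A : set Y) (b : R) :
  \sum_(i | y i \notin A) expR (u i x - u j x) <= b ->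
  ((1 - b)%:E <= exponential_kernel x A)%E.
Proof.
move=> sb; rewrite /exponential_kernel emechE lee_fin.
rewrite lerBlDr -(sum_emech_weight x) [leLHS](bigID (fun i => y i \in A))/=.
rewrite [X in _ <= X + _](bigID (fun i => y i \in A))/= -addrA lerD//.
  by apply: ler_sum => i iA; rewrite indicE iA mulr1.
rewrite -[leLHS]add0r lerD//.
  by apply: sumr_ge0 => i _; rewrite mulr_ge0 ?emech_weight_ge0// indicE.
rewrite (le_trans _ sb)//; apply: ler_sum => i _.
rewrite expRD expRN ler_pM2l ?expR_gt0// lef_pV2 ?posrE ?expR_gt0 ?emech_norm_gt0//.
rewrite /emech_norm (bigD1 j)//= lerDl; apply: sumr_ge0 => k _; exact: expR_ge0.
Qed.

End exponential_mechanism.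

(** * Penalty, direction net and grid *)

Section score.
Context {R : realType} {d : nat} {J : finType} (v : J -> d.-tuple R) (T : R).
Hypothesis T0 : 0 < T.

Definition dirsum n (x : n.-tuple (d.-tuple R)) (y : d.-tuple R) (j : J) : R :=
  \sum_(i < n) clip T (dot (subt (tnth x i) y) (v j)).

Definition score n (y : d.-tuple R) (x : n.-tuple (d.-tuple R)) : R :=
  \big[Num.max/0]_(j : J) `|dirsum x y j|.

Lemma dirsum_neighbours n (x x' : n.-tuple (d.-tuple R)) y j : neighbours x x' ->
  `|dirsum x y j - dirsum x' y j| <= 2 * T.
Proof.
move=> [i [_ xx']]; rewrite /dirsum (bigD1 i)//= [X in _ - X](bigD1 i)//=.
rewrite [X in _ + X - _](eq_bigr (fun l => clip T (dot (subt (tnth x' l) y) (v j)))).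
  rewrite opprD addrACA subrr addr0 (le_trans (ler_normB _ _))//.
  by rewrite mulr_natl mulr2n lerD// clip_le// ltW.
by move=> l li; rewrite xx'.
Qed.

(** A maximum moves by no more than its entries do. This sensitivity calibrates the mechanism. *)
Lemma score_neighbours n (x x' : n.-tuple (d.-tuple R)) y : neighbours x x' ->
  `|score y x - score y x'| <= 2 * T.
Proof.
have H (z z' : n.-tuple (d.-tuple R)) :
    (forall j, `|dirsum z y j - dirsum z' y j| <= 2 * T) ->
    score y z <= score y z' + 2 * T.
  move=> zz'; apply: bigmax_le => [|j _].
    by rewrite addr_ge0 ?bigmax_ge_id// mulr_ge0// ltW.
  rewrite -[dirsum z y j](subrKC (dirsum z' y j)) (le_trans (ler_normD _ _))// lerD//.
  exact: le_bigmax.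
move=> xx'; have h1 : score y x <= score y x' + 2 * T.
  by apply: H => j; exact: dirsum_neighbours.
have h2 : score y x' <= score y x + 2 * T.
  by apply: H => j; rewrite distrC; exact: dirsum_neighbours.
by rewrite ler_norml; lra.
Qed.

Lemma measurable_score n y : measurable_fun setT (@score n y).
Proof.
rewrite /score; elim: (index_enum J) => [|j s IH].
  under eq_fun do rewrite big_nil.
  exact: measurable_cst.
under eq_fun do rewrite big_cons.
apply: measurable_maxr => //; apply: measurableT_comp => //.
apply: measurable_sum => i; apply: (measurableT_comp (measurable_clip T)).
apply: (measurableT_comp (measurable_dot_subt y (v j))).
exact: measurable_tnth.
Qed.

Variables (n : nat) (x : n.-tuple (d.-tuple R)) (mu : d.-tuple R) (a : R).
Hypothesis v1 : forall j, norm2 (v j) <= 1.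
Hypothesis vnet : forall u, exists j, norm2 u / 2 <= dot u (v j).
Hypothesis a0 : 0 < a.
Hypothesis xclip : forall j, `|dirsum x mu j| <= n%:R * (a / 20).
Hypothesis xtail : forall j,
  \sum_(i < n) half_tail T (dot (subt (tnth x i) mu) (v j)) <= n%:R / 4.

Lemma dot_shift i y j : dot (subt (tnth x i) y) (v j) =
  dot (subt (tnth x i) mu) (v j) + dot (subt mu y) (v j).
Proof. rewrite !dot_subt; ring. Qed.

(** Half of the bound comes from [xclip] at [mu], half from moving [mu] to [y], since [clip] is
    1-Lipschitz. *)
Lemma score_upper y : norm2 (subt mu y) <= a / 20 -> score y x <= n%:R * (a / 10).
Proof.
move=> ya; apply: bigmax_le => [|j _]; first by rewrite mulr_ge0// divr_ge0// ltW.
rewrite -[dirsum x y j](subrKC (dirsum x mu j)) (le_trans (ler_normD _ _))//.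
rewrite (_ : a / 10 = a / 20 + a / 20); last by lra.
rewrite mulrDr lerD// /dirsum -sumrB (le_trans (ler_norm_sum _ _ _))//.
rewrite -[X in X%:R * _]card_ord mulr_natl -sumr_const; apply: ler_sum => i _.
rewrite dot_shift (le_trans (clip_lipschitz _ _ (ltW T0)))//.
rewrite (le_trans (normr_dot_le_norm2 _ _))// (le_trans _ ya)//.
by rewrite ler_piMr// norm2_ge0.
Qed.

(* Truncated projections only increase under the shift by [<mu - y, v>], and those
   with [|<x_i - mu, v>| <= T / 2] do so by the full amount, capped at [T / 2]. *)
Lemma score_lower y :
  n%:R * (Num.min (norm2 (subt mu y)) T / 4 - a / 20) <= score y x.
Proof.
have [j sj] := vnet (subt mu y).
set s := dot _ _ in sj; set del := norm2 _ in sj *.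
have del0 : 0 <= del by exact: norm2_ge0.
(* The halving serves twice: the net direction captures half of [del], and [clip_add] needs a shift
   of at most [T / 2]. *)
pose s' := Num.min del T / 2.
have s'0 : 0 <= s' by rewrite divr_ge0// le_min del0 ltW.
have s'T : s' <= T / 2 by rewrite ler_pM2r// ge_min lexx orbT.
have s's : s' <= s by rewrite (le_trans _ sj)// ler_pM2r// ge_min lexx.
have dj : `|dirsum x y j| <= score y x by exact: le_bigmax.
apply: le_trans dj; apply: le_trans (ler_norm _).
pose b i : R := (T / 2 < `|dot (subt (tnth x i) mu) (v j)|)%R%:R.
(* [b i] marks the samples that need not gain from the shift. By [xtail] they are at most half of
   all, so the total gain is at least [n * s' / 2]. *)
apply: (@le_trans _ _ (\sum_(i < n)
    (clip T (dot (subt (tnth x i) mu) (v j)) + s' * (1 - b i)))).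
  rewrite big_split/= -mulr_sumr sumrB sumr_const card_ord -/(dirsum x mu j).
  have := xclip j; rewrite ler_norml => /andP[h _].
  have := xtail j; rewrite -mulr_sumr -/b => h2.
  have n0 : 0 <= n%:R :> R by [].
  have -> : Num.min del T / 4 = s' / 2 by rewrite /s'; lra.
  have : s' * (2^-1 * \sum_(i < n) b i) <= s' * (n%:R / 4) by rewrite ler_wpM2l.
  set S := \sum_(i < n) b i; set nn : R := n%:R; lra.
apply: ler_sum => i _; rewrite (dot_shift i y) -/s.
set z := dot _ _.
apply: (@le_trans _ _ (clip T (z + s'))).
  rewrite /b -/z; case: (ltP (T / 2) `|z|) => zT.
    by rewrite subrr mulr0 addr0; apply: clip_homo => //; exact: ltW.
  by rewrite subr0 mulr1 clip_add// s'0.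
rewrite -[s](subrKC s') addrA; apply: clip_homo; first exact: ltW.
by rewrite subr_ge0.
Qed.

(** With [m] the minimum, [a <= m] gives [m / 4 - a / 20 - a / 10 >= m / 10]. *)
Lemma score_gap y y' : a <= T -> norm2 (subt mu y') <= a / 20 -> a < norm2 (subt mu y) ->
  n%:R * (Num.min (norm2 (subt mu y)) T / 10) <= score y x - score y' x.
Proof.
move=> aT y'a ya; have := score_upper y'a; have := score_lower y.
set del := norm2 _ in ya *; set m := Num.min _ _.
have am : a <= m by rewrite le_min (ltW ya).
have : n%:R * a <= n%:R * m by rewrite ler_wpM2l.
set nn : R := n%:R; lra.
Qed.

End score.

(** * A finite net of directions *)

Section direction_net.
Context {R : realType} {d : nat}.

(** Coordinates of the normalised [u] are rounded towards 0 to multiples of [1 / (2 d)], which keeps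
    the point in the unit ball. The loss in the inner product is at most the 1-norm of [u] over
    [2 d], hence at most [norm2 u / 2]. *)
Lemma direction_net : (0 < d)%N -> exists (J : finType) (v : J -> d.-tuple R),
  [/\ forall j, norm2 (v j) <= 1,
      forall u, exists j, norm2 u / 2 <= dot u (v j) &
      #|J| = ((4 * d).+1 ^ d)%N].
Proof.
move=> d0; pose N := (2 * d)%N.
have N0 : 0 < N%:R :> R by rewrite ltr0n muln_gt0.
pose J := {ffun 'I_d -> 'I_(4 * d).+1}.
pose w (f : J) : d.-tuple R := [tuple ((f i)%:R - N%:R) / N%:R | i < d].
pose o : d.-tuple R := [tuple 0 | i < d].
have o0 u : dot u o = 0 by rewrite /dot big1// => i _; rewrite tnth_mktuple mulr0.
(* Lattice points outside the unit ball are sent to 0, so that the index type stays a full function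
   space. *)
exists J, (fun f => if norm2 (w f) <= 1 then w f else o); split.
- move=> f; case: ifP => // _.
  by rewrite /norm2 o0 sqrtr0.
- move=> u; have [u0|u0] := eqVneq (norm2 u) 0.
    exists [ffun => ord0]; rewrite u0 mul0r; case: ifP; rewrite ?o0//.
    rewrite /dot big1// => i _; have := normr_tnth_le_norm2 u i.
    by rewrite u0 normr_le0 => /eqP ->; rewrite mul0r.
  have up : 0 < norm2 u by rewrite lt_neqAle eq_sym u0 norm2_ge0.
  pose t i := N%:R * `|tnth u i| / norm2 u.
  have t0 i : 0 <= t i by rewrite divr_ge0 ?mulr_ge0// ltW.
  pose m i := Num.truncn (t i).
  have mt i : (m i)%:R <= t i by have /andP[] := truncn_itv (t0 i).
  have tm i : t i < (m i).+1%:R by exact: truncnS_gt.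
  have mN i : (m i <= N)%N.
    rewrite -(ler_nat R) (le_trans (mt i))// ler_pdivrMr// ler_wpM2l//.
    exact: normr_tnth_le_norm2.
  (* Indices [0 .. 4 d] encode the integers from [- 2 d] to [2 d], shifted by [N]. *)
  pose z i := (if (0 <= tnth u i)%R then N + m i else N - m i)%N.
  have zlt i : (z i < (4 * d).+1)%N.
    by have := mN i; rewrite /z /N; case: ifP => _; lia.
  pose f : J := [ffun i => Ordinal (zlt i)].
  have wf i : tnth (w f) i = (if 0 <= tnth u i then 1 else -1) * (m i)%:R / N%:R.
    rewrite tnth_mktuple ffunE /= /z; case: ifP => _.
      by rewrite natrD addrC addKr mul1r.
    by rewrite natrB// addrC addKr mulN1r.
  exists f; have -> : norm2 (w f) <= 1.
    rewrite -(@ler_pXn2r _ 2)// ?nnegrE ?norm2_ge0// expr1n sqr_norm2.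
    rewrite -(divff (lt0r_neq0 (exprn_gt0 2 up))) sqr_norm2 {2}/dot mulr_suml.
    apply: ler_sum => i _.
    rewrite wf -!expr2 exprMn exprMn (_ : (if _ then _ else _) ^+ 2 = 1); last first.
      by case: ifP; rewrite ?expr1n// sqrrN expr1n.
    rewrite mul1r -exprMn -[tnth u i ^+ 2]real_normK ?num_real// -sqr_norm2 -expr_div_n.
    rewrite ler_pXn2r// ?nnegrE ?divr_ge0// ?norm2_ge0//.
    by rewrite ler_pdivrMr// mulrAC -mulrA mulrC mulrAC -/(t i) mt.
  have -> : dot u (w f) = \sum_(i < d) `|tnth u i| * ((m i)%:R / N%:R).
    apply: eq_bigr => i _; rewrite wf; case: (leP 0 (tnth u i)) => ui.
      by rewrite mul1r ger0_norm.
    by rewrite mulN1r ltr0_norm// mulNr mulrN mulNr.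
  apply: (@le_trans _ _ (\sum_(i < d)
      (tnth u i * tnth u i / norm2 u - `|tnth u i| / N%:R))).
    rewrite sumrB -!mulr_suml -/(dot u u) -sqr_norm2 expr2 mulfK//.
    have := norm1_le_norm2 u; set S := \sum_(i < d) _ => Su.
    have : S / N%:R <= norm2 u / 2; last lra.
    rewrite ler_pdivrMr// (le_trans Su)// mulrC /N natrM mulrA divfK//.
    rewrite ler_wpM2l ?norm2_ge0//.
    rewrite -[leRHS]ger0_norm// -sqrtr_sqr ler_sqrt ?sqr_ge0// expr2 -natrM ler_nat.
    by rewrite leq_pmull.
  apply: ler_sum => i _; rewrite lerBlDr -mulrDr.
  rewrite (_ : _ / _ + _ = (m i).+1%:R / N%:R); last by rewrite -natr1 mulrDl mul1r.
  rewrite -expr2 -[tnth u i ^+ 2]real_normK ?num_real// expr2 -mulrA ler_wpM2l//.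
  by rewrite ler_pdivlMr// (le_trans _ (ltW (tm i)))// /t mulrC mulrA.
- by rewrite card_ffun !card_ord.
Qed.

End direction_net.

(** * The grid of candidate outputs and sums over it *)

Section grid.
Context {R : realType}.

Lemma geometric_sum_le2 M : \sum_(j < M) (2^-1 : R) ^+ j <= 2.
Proof.
suff -> : \sum_(j < M) (2^-1 : R) ^+ j = 2 - 2 * 2^-1 ^+ M.
  by rewrite gerBl mulr_ge0// exprn_ge0.
elim: M => [|M IH]; first by rewrite big_ord0 expr0 mulr1 subrr.
by rewrite big_ord_recr/= IH exprS; field.
Qed.

(** With truncated subtraction the exponent is the distance from [j] to [a]. The subtracted
    [2^-1 ^+ a] makes the induction on [a] close: the new first term is exactly the increase of the
    bound. *)
Lemma two_sided_geometric_sum M a :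
  \sum_(j < M) (2^-1 : R) ^+ ((j - a) + (a - j)) <= 3 - 2^-1 ^+ a.
Proof.
elim: a M => [|a IH] M.
  rewrite expr0 (eq_bigr (fun j : 'I_M => (2^-1 : R) ^+ j)).
    by rewrite (le_trans (geometric_sum_le2 M))//; lra.
  by move=> j _; rewrite subn0 sub0n addn0.
case: M => [|M].
  rewrite big_ord0 subr_ge0 (@le_trans _ _ 1)//; last by lra.
  by rewrite exprn_ile1//; lra.
rewrite big_ord_recl/= sub0n subn0 add0n.
have -> : \sum_(i < M) (2^-1 : R) ^+ (bump 0 i - a.+1 + (a.+1 - bump 0 i)) =
    \sum_(i < M) 2^-1 ^+ (i - a + (a - i)).
  by apply: eq_bigr => i _; rewrite /bump/= add1n !subSS.
have := IH M; rewrite exprS; set q := _ ^+ a; lra.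
Qed.

Lemma expR_dist_le (j a : nat) :
  expR (- `|j%:R - a%:R : R|) <= 2^-1 ^+ ((j - a) + (a - j)).
Proof.
have -> : `|j%:R - a%:R : R| = ((j - a) + (a - j))%N%:R.
  case: (leqP a j) => ja.
    by rewrite -natrB// normr_nat (eqP ja) addn0.
  by rewrite distrC -natrB 1?ltnW// normr_nat (eqP (ltnW ja)) add0n.
rewrite -mulrN1 expRM_natl lerXn2r ?nnegrE ?expR_ge0//.
rewrite expRN lef_pV2 ?posrE ?expR_gt0//.
by rewrite (le_trans _ (expR_ge1Dx _)).
Qed.

Context {d : nat} (M : nat) (r h : R).

Definition grid_point (f : {ffun 'I_d -> 'I_M}) : d.-tuple R :=
  [tuple - r + (f i)%:R * h | i < d].

Lemma tnth_grid_point f i : tnth (grid_point f) i = - r + (f i)%:R * h.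
Proof. by rewrite tnth_mktuple. Qed.

Lemma grid_cover (mu : d.-tuple R) : 0 < h -> norm2 mu <= r -> 2 * r < M%:R * h ->
  exists f : {ffun 'I_d -> 'I_M}, forall i, `|tnth (subt mu (grid_point f)) i| <= h.
Proof.
move=> h0 mur rM.
pose t i := (tnth mu i + r) / h.
have t0 i : 0 <= t i.
  rewrite divr_ge0 ?(ltW h0)//; have := normr_tnth_le_norm2 mu i.
  by rewrite ler_norml => /andP[]; lra.
pose m i := Num.truncn (t i).
have mt i : (m i)%:R <= t i < (m i).+1%:R by exact: truncn_itv.
have mM i : (m i < M)%N.
  have /andP[mti _] := mt i.
  rewrite -(ltr_nat R) (le_lt_trans mti)// ltr_pdivrMr// (le_lt_trans _ rM)//.
  by have := normr_tnth_le_norm2 mu i; rewrite ler_norml => /andP[_]; lra.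
exists [ffun i => Ordinal (mM i)] => i.
rewrite tnth_subt tnth_grid_point ffunE/=.
have /andP[] := mt i; rewrite ler_pdivlMr// ltr_pdivrMr// -natr1 => h1 h2.
by rewrite ler_norml; lra.
Qed.

(** In each coordinate, replacing [mu] by the grid point of [g] costs at most [h], whence the [- d];
    the passage from the 1-norm costs [sqrt d]. *)
Lemma grid_dist_lower (mu : d.-tuple R) (f g : {ffun 'I_d -> 'I_M}) :
  0 <= h -> (0 < d)%N -> (forall i, `|tnth (subt mu (grid_point g)) i| <= h) ->
  h * (\sum_(i < d) `|(f i)%:R - (g i)%:R : R| - d%:R) <=
    Num.sqrt d%:R * norm2 (subt mu (grid_point f)).
Proof.
move=> h0 d0 gmu; rewrite (le_trans _ (norm1_le_norm2 _))//.
rewrite -[X in _ - X%:R]card_ord -sumr_const -sumrB mulr_sumr.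
apply: ler_sum => i _; have := gmu i; rewrite !tnth_subt !tnth_grid_point.
rewrite mulrBr mulr1 -[h in h * `|_|]ger0_norm// -normrM.
set u := tnth mu i; set p : R := (f i)%:R; set q : R := (g i)%:R.
have := ler_normB (u - (- r + q * h)) (u - (- r + p * h)).
rewrite (_ : u - (- r + q * h) - _ = h * (p - q)); last by ring.
lra.
Qed.

(** The sum factors over coordinates into two-sided geometric sums, each at most 3. *)
Lemma sum_expR_grid (g : {ffun 'I_d -> 'I_M}) :
  \sum_(f : {ffun 'I_d -> 'I_M}) expR (- \sum_(i < d) `|(f i)%:R - (g i)%:R : R|)
    <= 3 ^+ d.
Proof.
under eq_bigr do rewrite -sumrN expR_sum.
rewrite -(bigA_distr_bigA (fun i (j : 'I_M) => expR (- `|j%:R - (g i)%:R : R|))).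
rewrite -[X in 3 ^+ X]card_ord -prodr_const; apply: ler_prod => i _.
apply/andP; split; first by apply: sumr_ge0 => j _; exact: expR_ge0.
apply: (@le_trans _ _ (3 - 2^-1 ^+ (g i))); last first.
  by rewrite gerBl exprn_ge0.
rewrite (le_trans _ (two_sided_geometric_sum M (g i)))//.
by apply: ler_sum => j _; exact: expR_dist_le.
Qed.

(* A point outside the [a]-ball is either within distance [T] of the center, where
   the weights decay geometrically along the grid, or beyond, where the crude count
   [M ^ d] suffices. *)
Lemma grid_sum_le (mu : d.-tuple R) (g : {ffun 'I_d -> 'I_M}) (a c T : R) :
  (0 < d)%N -> 0 < a -> 0 <= c -> h = a / (20 * Num.sqrt d%:R) ->
  (forall i, `|tnth (subt mu (grid_point g)) i| <= h) -> 40 * d%:R <= c * a ->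
  \sum_(f : {ffun 'I_d -> 'I_M} | a < norm2 (subt mu (grid_point f)))
     expR (- (c * Num.min (norm2 (subt mu (grid_point f))) T)) <=
  3 ^+ d * expR (- (19 / 40 * (c * a))) + M%:R ^+ d * expR (- (c * T)).
Proof.
move=> d0 a0 c0 hE gmu dca.
set q : R := Num.sqrt d%:R in hE *.
have sd0 : 0 < q by rewrite sqrtr_gt0 ltr0n.
have sd2 : q * q = d%:R by rewrite -expr2 sqr_sqrtr.
have h0 : 0 < h by rewrite hE divr_gt0// mulr_gt0.
have dR0 : 0 < d%:R :> R by rewrite ltr0n.
pose S (f : {ffun 'I_d -> 'I_M}) : R := \sum_(i < d) `|(f i)%:R - (g i)%:R : R|.
have S0 f : 0 <= S f by apply: sumr_ge0 => i _.
apply: (@le_trans _ _ (\sum_(f : {ffun 'I_d -> 'I_M})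
   (expR (- (19 / 40 * (c * a))) * expR (- S f) + expR (- (c * T))))).
  rewrite [leLHS]big_mkcond/=; apply: ler_sum => f _; case: ifP => [af|_]; last first.
    by rewrite addr_ge0 ?mulr_ge0 ?expR_ge0.
  set del := norm2 _ in af *.
  have [Td|dT] := leP T del.
    by rewrite lerDr mulr_ge0 ?expR_ge0.
  rewrite (@le_trans _ _ (expR (- (19 / 40 * (c * a))) * expR (- S f)))//; last first.
    by rewrite lerDl expR_ge0.
  rewrite -expRD ler_expR -opprD lerN2.
  have := grid_dist_lower f (ltW h0) d0 gmu; rewrite -/del -/(S f) -/q => key.
  have key2 : S f / (20 * d%:R) * a - a / 20 <= del.
    rewrite -(ler_pM2l sd0) (le_trans _ key)// hE le_eqVlt; apply/orP; left; apply/eqP.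
    rewrite -sd2; field; by rewrite gt_eqF.
  have key3 : c * (S f / (20 * d%:R) * a - a / 20) <= c * del by rewrite ler_wpM2l.
  have key4 : c * a <= c * del by rewrite ler_wpM2l// ltW.
  have key5 : S f <= c * a * (S f / (40 * d%:R)).
    rewrite mulrA ler_pdivlMr ?mulr_gt0// mulrC ler_wpM2r//.
  (* One half gives [c * a / 2] by [key4], the other [S f - c * a / 40] by [key3] and [key5]; this
     is where 19/40 comes from. *)
  have -> : c * del = c * del / 2 + c * del / 2 by lra.
  have : c * a * (S f / (40 * d%:R)) - c * a / 40 <= c * del / 2; last lra.
  rewrite (_ : _ - _ = c * (S f / (20 * d%:R) * a - a / 20) / 2); first lra.
  by field; rewrite gt_eqF.
rewrite big_split/= -mulr_sumr sumr_const card_ffun !card_ord.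
rewrite -[X in _ + X]mulr_natl natrX lerD2r mulrC.
by rewrite ler_wpM2r ?expR_ge0// sum_expR_grid.
Qed.

End grid.

(** * Choice of the constants *)

Section failure_budget.
Context {R : realType}.

Lemma ln_le_sub1 (x : R) : 0 < x -> ln x <= x - 1.
Proof.
move=> x0; have := expR_ge1Dx (ln x); rewrite lnK ?posrE//; lra.
Qed.

Lemma exprn_expR (x : R) (d : nat) : 0 < x -> x ^+ d = expR (d%:R * ln x).
Proof. by move=> x0; rewrite expRM_natl lnK ?posrE. Qed.

Lemma natr_le_expR (m : nat) (x : R) : m%:R <= x -> m.+1%:R <= expR x.
Proof.
by move=> mx; rewrite -natr1 addrC (le_trans _ (expR_ge1Dx _))// lerD2l.
Qed.

Variables (d : nat) (l L b : R).

Let U : R := d%:R * L.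

(** Used with [L = ln (d / b)] and [l = - ln b0]. The positive lower bound [l] lets [d] and absolute
    constants be absorbed into multiples of [U / l]. *)
Definition budget := [/\ (0 < d)%N, 0 < l, l <= L, ln d%:R <= L & expR (- L) <= b].

Lemma budget_facts : budget ->
  [/\ 1 <= d%:R :> R, d%:R <= U / l, 1 <= U / l, L <= U & d%:R * ln d%:R <= U].
Proof.
move=> [d0 l0 lL dL _]; have d1 : 1 <= d%:R :> R by rewrite ler1n.
have L0 : 0 < L by rewrite (lt_le_trans l0).
have dU : d%:R <= U / l by rewrite ler_pdivlMr// /U ler_wpM2l.
split => //; first exact: le_trans dU.
- by rewrite /U ler_peMl// ltW.
- by rewrite /U ler_wpM2l.
Qed.

(** The net has at most [(5 d) ^ d <= expR (4 U / l + U)] points, the numerical factor 6 costs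
    [5 U / l], and the remaining [U] pays for [b]. *)
Lemma net_budget (E1 E2 : R) : budget ->
  (9 / l + 2) * U <= E1 -> (9 / l + 2) * U <= E2 ->
  ((4 * d).+1 ^ d)%:R * (2 * expR (- E1) + expR (- E2)) <= b / 2.
Proof.
move=> bu E1U E2U; have [d1 dU U1 LU ldU] := budget_facts bu.
have [d0 l0 lL dL Lb] := bu.
pose E := (9 / l + 2) * U.
have h1 : 2 * expR (- E1) + expR (- E2) <= 3 * expR (- E).
  have e1 : expR (- E1) <= expR (- E) by rewrite ler_expR lerN2.
  have e2 : expR (- E2) <= expR (- E) by rewrite ler_expR lerN2.
  lra.
have h2 : ((4 * d).+1 ^ d)%:R <= expR (4 * (U / l) + U) :> R.
  rewrite natrX (@le_trans _ _ ((5 * d%:R) ^+ d))//.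
    rewrite lerXn2r ?nnegrE ?mulr_ge0// -natr1 natrM; lra.
  rewrite exprn_expR ?mulr_gt0 ?ltr0n// ler_expR lnM ?posrE ?ltr0n// mulrDr lerD//.
  rewrite [leLHS]mulrC ler_pM ?ln_ge0//; first lra.
  by rewrite (le_trans (ln_le_sub1 _))//; lra.
have h3 : 6 <= expR (5 * (U / l)) :> R by apply: natr_le_expR; lra.
rewrite (@le_trans _ _ (expR (4 * (U / l) + U) * (3 * expR (- E))))//.
  by rewrite ler_pM// ?addr_ge0 ?mulr_ge0 ?expR_ge0.
rewrite ler_pdivlMr// (le_trans _ Lb)//.
rewrite (@le_trans _ _ (expR (4 * (U / l) + U) * (expR (5 * (U / l)) * expR (- E))))//.
  rewrite -[leLHS]mulrA ler_wpM2l ?expR_ge0// mulrAC ler_wpM2r ?expR_ge0//; lra.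
rewrite -!expRD ler_expR /E; lra.
Qed.

(** [3 ^+ d] costs [2 U / l], the factor 4 costs [3 U / l], and [U] pays for [b]. *)
Lemma near_budget (E : R) : budget -> (5 / l + 1) * U <= E ->
  3 ^+ d * expR (- E) <= b / 4.
Proof.
move=> bu EU; have [d1 dU U1 LU ldU] := budget_facts bu.
have [d0 l0 lL dL Lb] := bu.
have h2 : 3 ^+ d <= expR (2 * (U / l)) :> R.
  rewrite exprn_expR// ler_expR mulrC ler_pM ?ln_ge0//; first lra.
  by rewrite (le_trans (ln_le_sub1 _))//; lra.
have h3 : 4 <= expR (3 * (U / l)) :> R by apply: natr_le_expR; lra.
rewrite ler_pdivlMr// (le_trans _ Lb)//.
rewrite (@le_trans _ _ (expR (2 * (U / l)) * expR (- E) * expR (3 * (U / l))))//.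
  by rewrite ler_pM// ?mulr_ge0 ?exprn_ge0 ?expR_ge0// ler_wpM2r ?expR_ge0.
rewrite -!expRD ler_expR; lra.
Qed.

(** The logarithm of [a^-1] is crudely replaced by [a^-1]. The resulting [d / a] is paid by the
    privacy term of the sample bound, which grows at least like [1 / a] up to a constant. *)
Lemma far_budget (M : nat) (E G r a : R) : budget -> 0 < a -> 1 < r -> 1 <= G ->
  M%:R <= G * r * d%:R / a ->
  d%:R * G + d%:R * ln r + U + d%:R / a + 3 * (U / l) + U <= E ->
  M%:R ^+ d * expR (- E) <= b / 4.
Proof.
move=> bu a0 r1 G1 MG EU; have [d1 dU U1 LU ldU] := budget_facts bu.
have [d0 l0 lL dL Lb] := bu.
have G0 : 0 < G by lra.
have r0 : 0 < r by lra.
have d0R : 0 < d%:R :> R by rewrite ltr0n.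
have h2 : M%:R ^+ d <= expR (d%:R * G + d%:R * ln r + U + d%:R / a).
  rewrite (@le_trans _ _ ((G * r * d%:R / a) ^+ d))//.
    by rewrite lerXn2r// nnegrE// (le_trans _ MG).
  rewrite exprn_expR ?mulr_gt0 ?invr_gt0// ler_expR.
  rewrite !lnM ?posrE ?mulr_gt0 ?invr_gt0// !mulrDr.
  have h4 : d%:R * ln G <= d%:R * G.
    by rewrite ler_wpM2l// (le_trans (ln_le_sub1 _))//; lra.
  have h5 : d%:R * ln a^-1 <= d%:R / a.
    have ai : 0 < a^-1 by rewrite invr_gt0.
    by rewrite ler_wpM2l// (le_trans (ln_le_sub1 _))//; lra.
  lra.
have h3 : 4 <= expR (3 * (U / l)) :> R by apply: natr_le_expR; lra.
rewrite ler_pdivlMr// (le_trans _ Lb)//.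
rewrite (@le_trans _ _ (expR (d%:R * G + d%:R * ln r + U + d%:R / a) * expR (- E) *
    expR (3 * (U / l))))//.
  by rewrite ler_pM// ?mulr_ge0 ?exprn_ge0 ?expR_ge0// ler_wpM2r ?expR_ge0.
rewrite -!expRD ler_expR; lra.
Qed.

End failure_budget.

(** * Truncation level and Chernoff parameter *)

Section parameters.
Context {R : realType}.

Lemma powR_le_1Dbound (a a0 p : R) : 0 < a <= a0 -> 0 <= p <= 1 -> a `^ p <= 1 + a0.
Proof.
move=> /andP[a_gt0 aa0] /andP[p0 p1]; have [a1|a1] := leP a 1.
  rewrite (@le_trans _ _ 1)//; last by lra.
  by rewrite -(powRr0 a); apply: ger_powR => //; rewrite a_gt0.
by rewrite (le_trans (ler1_powR (ltW a1) p1))//; lra.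
Qed.

(** The 40 fixes the bias [a / 40]; one factor [1 + a0] absorbs the power of [a] in [trunc_level],
    the other remains in the lower bound on the level. *)
Definition trunc_scale (a0 : R) : R := 40 * (1 + a0) ^+ 2.

Definition trunc_level (a0 k a : R) : R := trunc_scale a0 / a `^ (k - 1)^-1.

(** The Chernoff parameter is this multiple of [a], small enough for the quadratic bound on the
    exponential of truncated projections. *)
Definition mgf_scale (a0 : R) : R := (8 * trunc_scale a0 * (1 + a0))^-1.

Variables (a0 k a : R).
Hypothesis a0_gt0 : 0 < a0.
Hypothesis k2 : 2 <= k.
Hypothesis aa0 : 0 < a <= a0.

Let K := trunc_scale a0.
Let T := trunc_level a0 k a.
Let p := (k - 1)^-1.

Let a_gt0 : 0 < a. Proof. by case/andP: aa0. Qed.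

Let k1 : 1 <= k - 1. Proof. by move: k2; lra. Qed.

Let p01 : 0 <= p <= 1.
Proof.
have k0 := lt_le_trans (ltr01 : 0 < 1 :> R) k1.
by rewrite /p invr_ge0 (ltW k0)/= invf_le1.
Qed.

Lemma trunc_scale_ge40 : 40 <= K.
Proof.
rewrite /K /trunc_scale ler_peMr// exprn_ege1//; move: a0_gt0; lra.
Qed.

Let K_gt0 : 0 < K. Proof. exact: lt_le_trans trunc_scale_ge40. Qed.

Lemma trunc_level_ge : 40 * (1 + a0) <= T.
Proof.
rewrite /T /trunc_level ler_pdivlMr ?powR_gt0// /trunc_scale.
have := powR_le_1Dbound aa0 p01; rewrite -/p; have := a0_gt0; nra.
Qed.

Lemma trunc_level_gt0 : 0 < T.
Proof. apply: lt_le_trans trunc_level_ge; have := a0_gt0; lra. Qed.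

(** The power of [a] collapses to [a], and [K ^ (1 - k) <= K^-1 <= 1 / 40]. *)
Lemma trunc_level_bias : T `^ (1 - k) <= a / 40.
Proof.
rewrite /T /trunc_level -/K -powRN powRM ?powR_ge0 ?(ltW K_gt0)// -powRrM.
have -> : - (k - 1)^-1 * (1 - k) = 1.
  by field; apply/eqP; have := k1; lra.
rewrite powRr1 ?(ltW a_gt0)// mulrC ler_wpM2l ?(ltW a_gt0)//.
rewrite (@le_trans _ _ (K `^ (-1)))//.
  by apply: ler_powR; have := k1; have := trunc_scale_ge40; lra.
by rewrite powR_inv1 ?(ltW K_gt0)// lef_pV2 ?posrE// trunc_scale_ge40.
Qed.

Lemma mgf_scale_gt0 : 0 < mgf_scale a0.
Proof. by rewrite invr_gt0 !mulr_gt0 ?K_gt0//; have := a0_gt0; lra. Qed.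

Lemma mgf_scale_le : mgf_scale a0 <= 320^-1.
Proof.
rewrite lef_pV2 ?posrE//; last by rewrite -invr_gt0 mgf_scale_gt0.
have h1 : 8 * 40 <= 8 * K by rewrite ler_wpM2l// trunc_scale_ge40.
have h2 : 8 * K <= 8 * K * (1 + a0).
  by rewrite mulrDr mulr1 lerDl; apply: mulr_ge0; [apply: mulr_ge0 => //|]; exact: ltW.
by rewrite (le_trans _ h2)// (le_trans _ h1)// -natrM.
Qed.

Lemma mgf_scale_level : mgf_scale a0 * a * T <= 1 / 2.
Proof.
have -> : mgf_scale a0 * a * T = (8 * (1 + a0))^-1 * a `^ (1 - p).
  rewrite powRB; last by apply/implyP => _; rewrite gt_eqF.
  rewrite powRr1 ?(ltW a_gt0)// /mgf_scale /T /trunc_level -/K -/p.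
  field; rewrite !gt_eqF//=; first by have := a0_gt0; lra.
  by rewrite powR_gt0.
have a1 : 0 < 1 + a0 by have := a0_gt0; lra.
rewrite ler_pdivrMl ?mulr_gt0//.
have := @powR_le_1Dbound a a0 (1 - p) aa0; have := p01 => /andP[p0 p1].
have p1' : 0 <= 1 - p <= 1 by lra.
move=> /(_ p1'); lra.
Qed.

Lemma rate_exponent : a `^ (k / (k - 1)) = a * a `^ p.
Proof.
have -> : k / (k - 1) = 1 + p by rewrite /p; field; apply/eqP; have := k1; lra.
rewrite powRD ?powRr1 ?(ltW a_gt0)//.
by apply/implyP => _; rewrite gt_eqF.
Qed.

(** The source of the exponent [k / (k - 1)] in the privacy term: the score gap near the mean is of
    order [n a], its sensitivity of order [T]. *)
Lemma rate_level : a / T = a `^ (k / (k - 1)) / K.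
Proof.
rewrite rate_exponent /T /trunc_level -/K -/p.
by field; rewrite !gt_eqF// powR_gt0.
Qed.

Lemma rate_le : a `^ (k / (k - 1)) <= a * (1 + a0).
Proof. by rewrite rate_exponent ler_wpM2l ?(ltW a_gt0)// powR_le_1Dbound. Qed.

End parameters.

(** * Sufficiency of the sample size *)

Section sample_size.
Context {R : realType}.

(** A sum dominating five thresholds: the two Chernoff bounds, [40 d <= c a], the near grid points
    and the far grid points. *)
Definition sample_const (a0 b0 : R) : R :=
  let l := - ln b0 in
  (80 / mgf_scale a0 + 8 * a0 ^+ 2) * (9 / l + 2) +
  (40 * (40 * trunc_scale a0) / l + 100 * trunc_scale a0 * (5 / l + 1) +
   40 * (((43 + a0) / l + 2) * (a0 * (1 + a0)) + (2 + a0) / l)).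

Lemma sample_const_facts (a0 b0 : R) : 0 < a0 -> 0 < b0 < 1 ->
  let l := - ln b0 in let c := sample_const a0 b0 in
  [/\ 0 < c, 80 / mgf_scale a0 * (9 / l + 2) <= c, 8 * a0 ^+ 2 * (9 / l + 2) <= c,
      40 * (40 * trunc_scale a0) / l <= c &
      100 * trunc_scale a0 * (5 / l + 1) <= c /\
      40 * (((43 + a0) / l + 2) * (a0 * (1 + a0)) + (2 + a0) / l) <= c].
Proof.
move=> a0_gt0 /andP[b0_gt0 b1] l c.
have l0 : 0 < l by rewrite oppr_gt0 ln_lt0// b0_gt0.
have K0 : 0 < trunc_scale a0 by rewrite (lt_le_trans _ (trunc_scale_ge40 a0_gt0)).
have kap0 := mgf_scale_gt0 a0_gt0.
have li : 0 < l^-1 by rewrite invr_gt0.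
have ki : 0 < (mgf_scale a0)^-1 by rewrite invr_gt0.
have e1 : 0 < 80 / mgf_scale a0 * (9 / l + 2) by rewrite mulr_gt0//; lra.
have e2 : 0 < 8 * a0 ^+ 2 * (9 / l + 2).
  by rewrite mulr_gt0 ?mulr_gt0 ?exprn_gt0//; lra.
have e3 : 0 < 40 * (40 * trunc_scale a0) / l by apply: divr_gt0 => //; lra.
have e4 : 0 < 100 * trunc_scale a0 * (5 / l + 1) by apply: mulr_gt0; lra.
have e5 : 0 < 40 * (((43 + a0) / l + 2) * (a0 * (1 + a0)) + (2 + a0) / l).
  apply: mulr_gt0; first lra.
  have : 0 < (43 + a0) / l by apply: divr_gt0 => //; lra.
  have : 0 < (2 + a0) / l by apply: divr_gt0 => //; lra.
  move=> f2 f1; apply: addr_gt0 => //; apply: mulr_gt0; first lra.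
  by apply: mulr_gt0 => //; lra.
by rewrite /c /sample_const -/l mulrDl; split; [..|split]; lra.
Qed.

Lemma budget_ln (d : nat) (b b0 : R) : (0 < d)%N -> 0 < b0 < 1 -> 0 < b <= b0 ->
  budget d (- ln b0) (ln (d%:R / b)) b.
Proof.
move=> d0 /andP[b0_gt0 b1] /andP[b_gt0 bb0].
have dR : 0 < d%:R :> R by rewrite ltr0n.
have lnd : 0 <= ln d%:R :> R by rewrite ln_ge0// ler1n.
have lnb : ln b <= ln b0 by rewrite ler_ln ?posrE.
have lnb0 : ln b0 < 0 by rewrite ln_lt0// b0_gt0.
rewrite ln_div ?posrE//; split => //; try lra.
by rewrite opprB addrC expRD expRN !lnK ?posrE// ler_piMl ?(ltW b_gt0)// invf_le1// ler1n.
Qed.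

(** In units of [n * kap * a ^+ 2], the threshold gives 1/20, the bias takes 1/40 and the quadratic
    term at most 1/80. *)
Lemma mgf_exponent_ge (n a kap t C U q : R) : 0 <= n -> 0 < a -> 0 < kap <= 320^-1 ->
  t <= a / 40 -> 80 / kap * q <= C -> 0 < U -> C * U <= n * a ^+ 2 ->
  q * U <= kap * a * (n * (a / 20)) - n * (kap * a * t + 4 * (kap * a) ^+ 2).
Proof.
move=> n0 a0 /andP[kap0 kap1] ta qC U0 CU.
apply: (@le_trans _ _ (n * a ^+ 2 * (kap / 80))).
  apply: (@le_trans _ _ (C * U * (kap / 80))); last first.
    by rewrite ler_wpM2r// divr_ge0// ltW.
  rewrite mulrAC ler_wpM2r ?(ltW U0)//.
  by move: qC; rewrite mulrAC ler_pdivrMr//; lra.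
have : n * (kap * a * t) <= n * (kap * a * (a / 40)).
  by rewrite ler_wpM2l// ler_wpM2l// mulr_ge0 ?(ltW kap0)// ltW.
have : n * a ^+ 2 * kap * kap <= n * a ^+ 2 * kap * 320^-1.
  by rewrite ler_wpM2l// !mulr_ge0// ?sqr_ge0// ltW.
lra.
Qed.

(** Since [8 / T ^+ 2 <= 1 / 8], at least [n / 8] remains; [a <= a0] turns the bound on [n * a ^+ 2]
    into one on [n]. *)
Lemma tail_exponent_ge (n a a0 T C U q : R) : 0 <= n -> 0 < a <= a0 ->
  40 * (1 + a0) <= T -> 8 * a0 ^+ 2 * q <= C -> 0 < U -> C * U <= n * a ^+ 2 ->
  q * U <= n / 4 - n * (8 / T ^+ 2).
Proof.
move=> n0 /andP[a_gt0 aa0] T40 qC U0 CU.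
have a0_gt0 : 0 < a0 by exact: lt_le_trans aa0.
have T0 : 0 < T by lra.
apply: (@le_trans _ _ (n / 8)).
  rewrite ler_pdivlMr// -(@ler_pM2r _ (a0 ^+ 2)) ?exprn_gt0//.
  apply: (@le_trans _ _ (C * U)).
    rewrite [leLHS](_ : _ = 8 * a0 ^+ 2 * q * U); last by ring.
    by rewrite ler_wpM2r// ltW.
  by rewrite (le_trans CU)// ler_wpM2l// ler_pXn2r// nnegrE ltW.
have : n * (8 / T ^+ 2) <= n / 8; last by lra.
by rewrite ler_wpM2l// ler_pdivrMr ?exprn_gt0//; nra.
Qed.

Lemma near_exponent_ge (ca K C U q : R) : 0 < K -> 0 <= q -> 0 < U ->
  100 * K * q <= C -> C * U / (40 * K) <= ca -> q * U <= 19 / 40 * ca.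
Proof.
move=> K0 q0 U0 qC Cca.
apply: (@le_trans _ _ (19 / 40 * (C * U / (40 * K)))); last by rewrite ler_wpM2l.
have h1 : 100 * K * q * U <= C * U by rewrite ler_wpM2r// ltW.
have -> : 19 / 40 * (C * U / (40 * K)) = 19 * (C * U) / (40 * (40 * K)).
  by field; rewrite gt_eqF.
rewrite ler_pdivlMr; last by lra.
have qU : 0 <= K * (q * U) by rewrite !mulr_ge0// ltW.
lra.
Qed.

Lemma grid_size_le (d : nat) (a a0 r : R) : (0 < d)%N -> 0 < a <= a0 -> 1 < r ->
  (Num.truncn (2 * r / (a / (20 * Num.sqrt d%:R)))).+1%:R <= (40 + a0) * r * d%:R / a.
Proof.
move=> d0 /andP[a_gt0 aa0] r1.
have a0_gt0 : 0 < a0 by exact: lt_le_trans aa0.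
have r0 : 0 < r by lra.
have d1 : 1 <= d%:R :> R by rewrite ler1n.
have sd0 : 0 < Num.sqrt d%:R :> R by rewrite sqrtr_gt0 ltr0n.
have sd1 : Num.sqrt d%:R <= d%:R :> R.
  by rewrite -[leRHS]ger0_norm// -sqrtr_sqr ler_sqrt ?sqr_ge0// expr2 ler_peMl.
set q := 2 * r / _.
have qE : q = 40 * r * Num.sqrt d%:R / a by rewrite /q; field; rewrite !gt_eqF.
have q0 : 0 <= q.
  by rewrite qE; apply: divr_ge0; [do 2 apply: mulr_ge0 => //|]; exact: ltW.
have /andP[qM _] := truncn_itv q0.
rewrite -[X in X <= _]natr1 (le_trans (lerD qM (lexx 1)))// qE.
rewrite ler_pdivlMr// mulrDl divfK ?gt_eqF// mul1r.
have : r * Num.sqrt d%:R <= r * d%:R by rewrite ler_wpM2l// ltW.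
(* The [+ 1] of the successor, multiplied by [a <= a0], is absorbed by the [a0] in [40 + a0]. *)
have : a0 <= a0 * (r * d%:R) by rewrite ler_peMr ?(ltW a0_gt0)// mulr_ege1// ltW.
lra.
Qed.

(** Here [E] stands for [n * eps]. In the threshold on [C], [(43 + a0) / l + 2] collects the
    multiples of [U], and [(2 + a0) / l] the terms [D * ln r] and [D / a]. *)
Lemma far_exponent_ge (D a a0 l r U C E : R) : 0 < a <= a0 -> 0 < l -> 0 < U ->
  0 < C -> 0 <= E -> 0 < ln r -> D <= U / l -> 1 <= U / l ->
  C * (U * ln r) <= E -> C * U <= E * (a * (1 + a0)) ->
  40 * (((43 + a0) / l + 2) * (a0 * (1 + a0)) + (2 + a0) / l) <= C ->
  D * (40 + a0) + D * ln r + U + D / a + 3 * (U / l) + U <= E / 40.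
Proof.
move=> /andP[a_gt0 aa0] l0 U0 C0 E0 lr0 DU U1 CUr CUa CE.
have a0_gt0 : 0 < a0 by exact: lt_le_trans aa0.
have li : 0 < l^-1 by rewrite invr_gt0.
have f1 : C * (D * ln r) <= E * l^-1.
  apply: (@le_trans _ _ (C * (U / l * ln r))).
    by rewrite ler_wpM2l ?(ltW C0)// ler_wpM2r// ltW.
  rewrite (_ : C * (U / l * ln r) = C * (U * ln r) * l^-1); last by ring.
  by rewrite ler_wpM2r// ltW.
have f2 : C * (D / a) <= E * ((1 + a0) / l).
  rewrite [leLHS]mulrA ler_pdivrMr//.
  apply: (@le_trans _ _ (C * (U / l))); first by rewrite ler_wpM2l// ltW.
  rewrite (_ : E * _ * a = E * (a * (1 + a0)) * l^-1); last by ring.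
  by rewrite mulrA ler_wpM2r// ltW.
have f3 : C * U <= E * (a0 * (1 + a0)).
  by rewrite (le_trans CUa)// ler_wpM2l// ler_wpM2r//; lra.
have f4 : C * D <= C * (U / l) by rewrite ler_wpM2l// ltW.
have f5 : E * (40 * (((43 + a0) / l + 2) * (a0 * (1 + a0)) + (2 + a0) / l)) <= E * C.
  by rewrite ler_wpM2l.
have q0 : 0 <= (43 + a0) / l + 2 by rewrite addr_ge0// divr_ge0 ?(ltW l0)//; lra.
have f6 := ler_wpM2l q0 f3.
have f7 : (40 + a0) * (C * D) <= (40 + a0) * (C * (U / l)) by rewrite ler_wpM2l//; lra.
rewrite -(ler_pM2l C0); clear CUr CUa CE DU U1 q0 f3 f4 aa0.
lra.
Qed.

(** Half of [b] goes to the samples, half to the mechanism. [c] is the score multiplier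
    [eps / (4 T)] times the gap factor [n / 10]. *)
Lemma sample_bound_sufficient (a0 b0 : R) (d : nat) (k r eps a b : R) (n : nat) :
  0 < a0 -> 0 < b0 < 1 -> (0 < d)%N -> 2 <= k -> 1 < r -> 0 < eps ->
  0 < a <= a0 -> 0 < b <= b0 ->
  sample_const a0 b0 * sample_bound d k r eps a b <= n%:R ->
  let T := trunc_level a0 k a in let l := mgf_scale a0 * a in
  let h := a / (20 * Num.sqrt d%:R) in let M := (Num.truncn (2 * r / h)).+1 in
  let c := eps * n%:R / (40 * T) in
  [/\ ((4 * d).+1 ^ d)%:R *
      (2 * expR (n%:R * (l * T `^ (1 - k) + 4 * l ^+ 2) - l * (n%:R * (a / 20)))
        + expR (n%:R * (8 / T ^+ 2) - n%:R / 4)) <= b / 2,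
      40 * d%:R <= c * a &
      3 ^+ d * expR (- (19 / 40 * (c * a))) + M%:R ^+ d * expR (- (c * T)) <= b / 2].
Proof.
move=> a0_gt0 b01 d0 k2 r1 eps0 aa0 bb0 cn T l h M c.
have [a_gt0 a_le] := andP aa0.
set b1 := - ln b0; set L := ln (d%:R / b).
have bu : budget d b1 L b by exact: budget_ln.
have [d1 dU U1 LU ldU] := budget_facts bu; have [_ b1_gt0 b1L _ _] := bu.
have [] := sample_const_facts a0_gt0 b01; rewrite -/b1 /=.
set C := sample_const a0 b0 in cn *; set K := trunc_scale a0; set kap := mgf_scale a0.
move=> C0 C1 C2 C3 [C4 C5].
pose U := d%:R * L; rewrite -/U in dU U1 LU ldU.
have L0 : 0 < L by exact: lt_le_trans b1L.
have dR0 : 0 < d%:R :> R by rewrite ltr0n.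
have U0 : 0 < U by rewrite mulr_gt0.
have K40 : 40 <= K := trunc_scale_ge40 a0_gt0.
have K0 : 0 < K by rewrite (lt_le_trans _ K40).
have kap0 : 0 < kap := mgf_scale_gt0 a0_gt0.
have kap1 : kap <= 320^-1 := mgf_scale_le a0_gt0.
have T40 : 40 * (1 + a0) <= T := trunc_level_ge a0_gt0 k2 aa0.
have T0 : 0 < T := trunc_level_gt0 a0_gt0 k2 aa0.
have lr0 : 0 < ln r by rewrite ln_gt0.
have n0 : 0 <= n%:R :> R by [].
pose rho := a `^ (k / (k - 1)).
have rho0 : 0 < rho by rewrite powR_gt0.
have rhole : rho <= a * (1 + a0) by exact: rate_le.
have aTE : a / T = rho / K by exact: rate_level.
have sbE : sample_bound d k r eps a b = U / a ^+ 2 + U / (eps * rho) + U * ln r / eps.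
  by rewrite /sample_bound -/L -/rho /U; congr (_ + _ + _);
    rewrite -!mulrA; congr (_ * _); rewrite mulrCA.
have t1 : 0 < U / a ^+ 2 by rewrite divr_gt0// exprn_gt0.
have t2 : 0 < U / (eps * rho) by rewrite divr_gt0// mulr_gt0.
have t3 : 0 < U * ln r / eps by rewrite divr_gt0// mulr_gt0.
(* Each of [H1], [H2], [H3] keeps one of the three positive summands of the sample bound. *)
have H1 : C * U <= n%:R * a ^+ 2.
  rewrite -ler_pdivrMr ?exprn_gt0// -mulrA (le_trans _ cn)// ler_pM2l// sbE.
  by rewrite -addrA lerDl addr_ge0// ltW.
have H2 : C * U <= n%:R * (eps * rho).
  rewrite -ler_pdivrMr ?mulr_gt0// -mulrA (le_trans _ cn)// ler_pM2l// sbE.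
  by rewrite addrAC lerDr addr_ge0// ltW.
have H3 : C * (U * ln r) <= n%:R * eps.
  rewrite -ler_pdivrMr// -mulrA (le_trans _ cn)// ler_pM2l// sbE.
  by rewrite lerDr addr_ge0// ltW.
have H4 : C * U <= n%:R * eps * (a * (1 + a0)).
  by rewrite (le_trans H2)// mulrA ler_wpM2l// mulr_ge0// ltW.
have caE : c * a = eps * n%:R * (rho / K) / 40.
  rewrite -aTE /c; field; by rewrite gt_eqF.
have cTE : c * T = eps * n%:R / 40 by rewrite /c; field; rewrite gt_eqF.
have caU : C * U / (40 * K) <= c * a.
  have -> : c * a = n%:R * (eps * rho) / (40 * K) by rewrite caE; field; rewrite gt_eqF.
  by rewrite ler_wpM2r// invr_ge0 mulr_ge0// ltW.
have ca_ge : 40 * d%:R <= c * a.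
  apply: le_trans caU; rewrite ler_pdivlMr; last by rewrite mulr_gt0.
  apply: (@le_trans _ _ (40 * (40 * K) / b1 * U)); last by rewrite ler_wpM2r// ltW.
  rewrite [leRHS](_ : _ = 40 * (40 * K) * (U / b1)); last by ring.
  rewrite [leLHS](_ : _ = 40 * (40 * K) * d%:R); last by ring.
  by apply: ler_wpM2l => //; do 2 apply: mulr_ge0 => //; exact: ltW.
split => //.
- rewrite [X in 2 * expR X + _](_ : _ = - (l * (n%:R * (a / 20)) -
    n%:R * (l * T `^ (1 - k) + 4 * l ^+ 2))); last by rewrite opprB.
  rewrite [X in _ + expR X](_ : _ = - (n%:R / 4 - n%:R * (8 / T ^+ 2))); last first.
    by rewrite opprB.
  have kap01 : 0 < kap <= 320^-1 by rewrite kap0.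
  have bias := trunc_level_bias a0_gt0 k2 aa0.
  apply: (net_budget bu).
    exact: (mgf_exponent_ge n0 a_gt0 kap01 bias C1 U0 H1).
  exact: (tail_exponent_ge n0 aa0 T40 C2 U0 H1).
- rewrite (_ : b / 2 = b / 4 + b / 4); last by field.
  apply: lerD.
    apply: (near_budget bu); rewrite -/U; apply: near_exponent_ge caU => //.
    by rewrite addr_ge0// divr_ge0// ltW.
  apply: (@far_budget _ d b1 L b M _ (40 + a0) r a bu) => //.
  + by rewrite (@le_trans _ _ 40)// ?ler1n// lerDl ltW.
  + exact: grid_size_le.
  rewrite cTE -/U; apply: (@far_exponent_ge d%:R a a0 b1 r U C) => //.
  + by rewrite mulr_ge0// ltW.
  + by rewrite (mulrC eps).
  + by rewrite (mulrC eps).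
Qed.

End sample_size.

(** * Concentration and conclusion *)

Lemma measure_fin_bigU_le d (T : measurableType d) (R : realType)
    (m : {measure set T -> \bar R}) (J : finType) (A : J -> set T) (b : R) :
  (forall j, measurable (A j)) -> (forall j, (m (A j) <= b%:E)%E) ->
  (m (\big[setU/set0]_(j : J) A j) <= (#|J|%:R * b)%:E)%E.
Proof.
move=> mA mb.
apply: (@le_trans _ _ (\sum_(j : J) m (A j))%E).
  elim: (index_enum J) => [|j s IH]; first by rewrite !big_nil measure0.
  rewrite !big_cons (le_trans (measureU2 _ _ _))//.
    by apply: bigsetU_measurable => i _.
  by rewrite leeD2l.
apply: (@le_trans _ _ (\sum_(j : J) b%:E)%E); first by apply: lee_sum => j _.
by rewrite sumEFin sumr_const mulr_natl.
Qed.

Section concentration.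
Context {R : realType} {d : nat} (D : probability (d.-tuple R) R).
Variables (mu : d.-tuple R) (k : R).
Hypothesis k2 : 2 <= k.
Hypothesis Dmean : has_mean D mu.
Hypothesis Dmoment : central_moment_le1 D mu k.
Context {dO : measure_display} {O : measurableType dO} (P : probability O R).
Variables (n : nat) (X : 'I_n -> {mfun O >-> d.-tuple R}).
Hypothesis iidX : iid P X D.

Let Z v (x : d.-tuple R) : R := dot (subt x mu) v.

Lemma clip_tail v T l t : norm2 v <= 1 -> 0 < T -> 0 < l -> l * T <= 1 / 2 ->
  (P [set w | (t <= \sum_(i < n) clip T (Z v (X i w)))%R] <=
   (expR (n%:R * (l * T `^ (1 - k) + 4 * l ^+ 2) - l * t))%:E)%E.
Proof.
move=> v1 T0 l0 lT.
rewrite (_ : [set w | _] = [set w | l * t <= \sum_(i < n) l * clip T (Z v (X i w))]).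
  apply: (iid_chernoff (f := fun x => l * clip T (Z v x)) (l * t) iidX).
    apply: measurable_funM => //.
    by apply: (measurableT_comp (measurable_clip T)); exact: measurable_dot_subt.
  exact: (integral_expR_clip k2 Dmean Dmoment v1 T0 (ltW l0) lT).
by apply/seteqP; split => w /=; rewrite -mulr_sumr ler_pM2l.
Qed.

Lemma large_tail v T : norm2 v <= 1 -> 0 < T ->
  (P [set w | (n%:R / 4 <= \sum_(i < n) half_tail T (Z v (X i w)))%R] <=
   (expR (n%:R * (8 / T ^+ 2) - n%:R / 4))%:E)%E.
Proof.
move=> v1 T0; apply: (iid_chernoff (f := fun x => half_tail T (Z v x)) _ iidX).
- exact: measurable_half_tail.
- exact: (integral_expR_tail k2 Dmean Dmoment).
Qed.

(** Only projections centred at [mu] occur, so the union bound runs over directions and not over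
    grid points. *)
Lemma uniform_concentration (J : finType) (v : J -> d.-tuple R) T l a :
  (forall j, norm2 (v j) <= 1) -> 0 < T -> 0 < l -> l * T <= 1 / 2 ->
  exists B : set O, [/\ measurable B,
    (P B <= (#|J|%:R *
       (2 * expR (n%:R * (l * T `^ (1 - k) + 4 * l ^+ 2) - l * (n%:R * (a / 20)))
        + expR (n%:R * (8 / T ^+ 2) - n%:R / 4)))%:E)%E &
    forall w, ~ B w -> forall j,
      `|dirsum v T [tuple X i w | i < n] mu j| <= n%:R * (a / 20) /\
      \sum_(i < n) half_tail T (dot (subt (tnth [tuple X i w | i < n] i) mu) (v j))
        <= n%:R / 4].
Proof.
move=> v1 T0 l0 lT.
set e1 := expR (_ - l * _); set e2 := expR (_ - _ / 4).
pose t := n%:R * (a / 20).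
have mclip u : measurable_fun setT (fun x => clip T (Z u x)).
  by apply: (measurableT_comp (measurable_clip T)); exact: measurable_dot_subt.
pose A u := [set w | t <= \sum_(i < n) clip T (Z u (X i w))].
pose Q u := [set w | (n%:R / 4 <= \sum_(i < n) half_tail T (Z u (X i w)))%R].
have mA u : measurable (A u) by exact: (measurable_sample_sum_ge X t (mclip u)).
have mQ u : measurable (Q u).
  exact: (measurable_sample_sum_ge X _ (measurable_half_tail _ _ _)).
(* As [clip] is odd, the opposite direction supplies the lower tail, whence the factor 2. *)
pose B j := A (v j) `|` A (oppt (v j)) `|` Q (v j).
have mB j : measurable (B j) by do 2 apply: measurableU => //.
exists (\big[setU/set0]_(j : J) B j); split.
- by apply: bigsetU_measurable => j _.
- apply: measure_fin_bigU_le => // j.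
  rewrite (le_trans (measureU2 _ _ _))//; first exact: measurableU.
  rewrite EFinD leeD//; last exact: large_tail.
  rewrite (le_trans (measureU2 _ _ _))// mulr_natl mulr2n EFinD leeD//;
    apply: clip_tail => //.
  by rewrite norm2_oppt.
- move=> w Bw j.
  have Bj : ~ B j w.
    apply: contra_not Bw => Bjw; rewrite -bigcup_seq.
    by exists j; rewrite //= mem_index_enum.
  have E1 : dirsum v T [tuple X i w | i < n] mu j = \sum_(i < n) clip T (Z (v j) (X i w)).
    by apply: eq_bigr => i _; rewrite tnth_mktuple.
  have E2 : \sum_(i < n) clip T (Z (oppt (v j)) (X i w)) =
      - \sum_(i < n) clip T (Z (v j) (X i w)).
    by rewrite -sumrN; apply: eq_bigr => i _; rewrite /Z dot_oppt clipN// ltW.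
  split.
    rewrite E1 ler_norml -/t lerNl -E2; apply/andP.
    split; rewrite leNgt; apply/negP => /ltW h.
      by apply: Bj; left; right.
    by apply: Bj; left; left.
  under eq_bigr do rewrite tnth_mktuple.
  by rewrite leNgt; apply/negP => /ltW h; apply: Bj; right.
Qed.

End concentration.

Lemma measurable_norm2_ball {R : realType} {d : nat} (mu : d.-tuple R) (a : R) :
  measurable [set y | norm2 (subt mu y) <= a].
Proof.
have -> : [set y | norm2 (subt mu y) <= a] =
    setT `&` (fun y => norm2 (subt mu y)) @^-1` `]-oo, a]%classic.
  by apply/seteqP; split => y; rewrite /= in_itv/= => // -[].
by apply: measurable_norm2_subt => //; exact: measurable_itv.
Qed.

(** The two sources of failure combine through [(1 - b / 2) ^+ 2 >= 1 - b]. *)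
Lemma output_prob_ge {dT dY dO : measure_display} {T : measurableType dT}
    {Y : measurableType dY} {O : measurableType dO} {R : realType}
    (P : probability O R) (M : algorithm T Y R) (n : nat)
    (X : 'I_n -> {mfun O >-> T}) (A : set Y) (B : set O) (b : R) :
  0 < b < 1 -> measurable A -> measurable B -> (P B <= (b / 2)%:E)%E ->
  (forall w, ~ B w -> ((1 - b / 2)%:E <= M n [tuple X i w | i < n] A)%E) ->
  ((1 - b)%:E <= output_prob P M X A)%E.
Proof.
move=> /andP[b0 b1] mA mB PB good; rewrite /output_prob.
apply: (@le_trans _ _ (\int[P]_w ((1 - b / 2)%:E * (\1_(~` B) w)%:E))%E); last first.
  apply: ge0_le_integral => //.
  - by move=> w _; rewrite -EFinM lee_fin mulr_ge0 ?indicE//; lra.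
  - apply: measurable_funeM; apply/measurable_EFinP; apply: measurable_indic.
    exact: measurableC.
  - apply: (measurableT_comp (measurable_kernel (M n) A mA)).
    apply/measurable_fun_tnthP => i.
    rewrite (_ : _ \o _ = X i)//.
    by apply/funext => w /=; rewrite tnth_mktuple.
  - move=> w _; rewrite indicE; case: (boolP (w \in ~` B)) => [/set_mem wB|_].
      by rewrite mule1 good.
    by rewrite mule0.
rewrite ge0_integralZl//; last 2 first.
- by apply/measurable_EFinP; apply: measurable_indic; exact: measurableC.
- by rewrite lee_fin; lra.
rewrite integral_indic//; last exact: measurableC.
rewrite setIT [X in (_ * X)%E](_ : _ = 1 - P B)%E; last exact: probability_setC.
have PBfin : P B \is a fin_num by rewrite ge0_fin_numE// (le_lt_trans PB)// ltry.
have qb : fine (P B) <= b / 2 by rewrite -lee_fin fineK.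
rewrite -(fineK PBfin) -EFinB -EFinM lee_fin; set q := fine _ in qb *.
have : 0 <= (1 - b / 2) * (b / 2 - q) by rewrite mulr_ge0//; lra.
have := sqr_ge0 b; lra.
Qed.

Theorem theorem5p8 (R : realType) (a0 b0 : R) :
  0 < a0 -> 0 < b0 < 1 ->
  exists2 c : R, 0 < c &
  forall (d : nat) (k r eps alpha beta : R),
    (1 <= d)%N -> 2 <= k -> 1 < r ->
    0 < eps -> 0 < alpha <= a0 -> 0 < beta <= b0 ->
  exists2 M : algorithm (d.-tuple R) (d.-tuple R) R,
    differentially_private eps M &
    forall (D : probability (d.-tuple R) R) (mu : d.-tuple R),
      has_mean D mu -> norm2 mu <= r -> central_moment_le1 D mu k ->
    forall (n : nat), c * sample_bound d k r eps alpha beta <= n%:R ->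
    forall (dO : measure_display) (O : measurableType dO)
      (P : probability O R) (X : 'I_n -> {mfun O >-> d.-tuple R}),
      iid P X D ->
    ((1 - beta)%:E <=
       output_prob P M X [set y | (norm2 (subt mu y) <= alpha)%R])%E.
Proof.
move=> a0_gt0 b01; exists (sample_const a0 b0).
  by have [] := sample_const_facts a0_gt0 b01.
move=> d k r eps a b d1 k2 r1 eps0 aa0 bb0.
have [a_gt0 a_le] := andP aa0; have [b_gt0 b_le] := andP bb0.
(* All parameters of the mechanism are fixed here, before the distribution, its mean and [n] are
   introduced. *)
pose T := trunc_level a0 k a; pose h := a / (20 * Num.sqrt d%:R).
pose N := (Num.truncn (2 * r / h)).+1.
have T0 : 0 < T := trunc_level_gt0 a0_gt0 k2 aa0.
have sd0 : 0 < Num.sqrt d%:R :> R by rewrite sqrtr_gt0 ltr0n.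
have h0 : 0 < h by rewrite divr_gt0// mulr_gt0.
have [J [v [v1 vnet cardJ]]] := @direction_net R d d1.
pose I := {ffun 'I_d -> 'I_N}.
pose i0 : I := [ffun => ord0].
pose y (f : I) : d.-tuple R := grid_point r h f.
(* Sensitivity [2 * T] times [eta] is [eps / 2], as [exponential_kernel_close] requires. *)
pose eta := eps / (4 * T).
have eta0 : 0 < eta by rewrite divr_gt0// mulr_gt0.
have mscore n (f : I) : measurable_fun setT
    (fun x : n.-tuple (d.-tuple R) => - eta * score v T (y f) x).
  by apply: measurable_funM => //; exact: measurable_score.
pose u n (f : I) : {mfun n.-tuple (d.-tuple R) >-> R} :=
  HB.pack (fun x : n.-tuple (d.-tuple R) => - eta * score v T (y f) x)
    (isMeasurableFun.Build _ _ _ _ _ (mscore n f)).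
exists (fun n => exponential_kernel i0 y (u n)).
  move=> n x x' xx' A mA; apply: exponential_kernel_close => f /=.
  rewrite -mulrBr normrM normrN (gtr0_norm eta0).
  have -> : eps / 2 = eta * (2 * T) by rewrite /eta; field; rewrite gt_eqF.
  by rewrite ler_pM2l//; exact: score_neighbours.
move=> D mu Dmean mur Dmoment n cn dO O P X iidX.
have [] := sample_bound_sufficient a0_gt0 b01 d1 k2 r1 eps0 aa0 bb0 cn.
rewrite -/T -/h -/N /=; set c := eps * n%:R / (40 * T); rewrite -cardJ.
move=> netb dca gridb.
have l0 : 0 < mgf_scale a0 * a by rewrite mulr_gt0// mgf_scale_gt0.
have [B [mB PB goodB]] := uniform_concentration k2 Dmean Dmoment iidX a v1 T0 l0
  (mgf_scale_level a0_gt0 k2 aa0).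
apply: (@output_prob_ge _ _ _ _ _ _ _ P _ n X _ B b) => //.
- by rewrite b_gt0 (le_lt_trans b_le)//; case/andP: b01.
- exact: measurable_norm2_ball.
- by rewrite (le_trans PB)// lee_fin.
move=> w Bw; have gw := goodB w Bw; set x := [tuple X i w | i < n] in gw *.
have rN : 2 * r < N%:R * h by rewrite -ltr_pdivrMr// truncnS_gt.
have [g gmu] := @grid_cover R d N r h mu h0 mur rN.
have gnear : norm2 (subt mu (y g)) <= a / 20.
  rewrite (le_trans (norm2_le_bound (ltW h0) gmu))// /h le_eqVlt; apply/orP; left.
  by apply/eqP; field; rewrite gt_eqF.
have aT : a <= T.
  by rewrite (le_trans _ (trunc_level_ge a0_gt0 k2 aa0))//; lra.
(* The bad outputs are compared with the grid point [g] near [mu], whose existence is all that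
   matters: the mechanism does not know it. *)
apply: (@exponential_kernel_utility _ _ _ _ _ _ i0 y (u n) g).
have c0 : 0 <= c by apply: divr_ge0; apply: mulr_ge0 => //; exact: ltW.
apply: le_trans gridb; apply: le_trans (grid_sum_le T d1 a_gt0 c0 erefl gmu dca).
rewrite (eq_bigl (fun f : I => a < norm2 (subt mu (y f)))); last first.
  by move=> f; rewrite ltNge; congr (~~ _); apply/idP/idP; rewrite inE.
apply: ler_sum => f af; rewrite ler_expR /=.
have := score_gap T0 v1 vnet a_gt0 (fun j => (gw j).1) (fun j => (gw j).2) aT gnear af.
set m := Num.min _ _ => gap.
have -> : c * m = eta * (n%:R * (m / 10)) by rewrite /c /eta; field; rewrite gt_eqF.
by have := ler_wpM2l (ltW eta0) gap; lra.
Qed.
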